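(* Let $u\in L^\infty([0,1]\times\mathbb T^2)$ be a vector field with $\nabla\cdot u=0$ and let $\theta_0\in L^2(\mathbb T^2)$. For all $\kappa>0$, let $\theta^\kappa$ solve $$\partial_t\theta^\kappa-\kappa\Delta\theta^\kappa+u\cdot\nabla\theta^\kappa=0\ \text{ in }(0,1)\times\mathbb T^2,\qquad\theta^\kappa(0,\cdot)=\theta_0.$$ Suppose that for some $\theta\in L^\infty([0,1],L^2(\mathbb T^2))$ and some sequence of positive numbers $\kappa_j\to0$, $\theta^{\kappa_j}\rightharpoonup\theta$ weakly-$*$ in $L^\infty([0,1],L^2(\mathbb T^2))$. Suppose also that $E(t):=\|\theta(t,\cdot)\|_{L^2(\mathbb T^2)}^2$ is not continuous (i.e. does not coincide for a.e. $t\in[0,1]$ with a continuous function). Then, for any $s>0$, $$\lim_{j\to\infty}\|\theta^{\kappa_j}\|_{L^\infty([0,1],H^s(\mathbb T^2))}=\infty.$$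
   Context: $\mathbb T^2$ is $[0,\sqrt2]\times[0,1]$ with periodic boundary. $\|f\|_{H^s(\mathbb T^2)}:=\|(-\Delta)^{s/2}f\|_{L^2(\mathbb T^2)}$, with $(-\Delta)^{s/2}$ defined via Fourier series (it annihilates constants; value $+\infty$ if not in $L^2$). *)

(* Defs.v *)
From HB Require Import structures.
From mathcomp Require Import all_boot all_order all_algebra.
From mathcomp Require Import all_classical all_reals all_analysis.
From mathcomp Require Import complex.

Set Implicit Arguments.
Unset Strict Implicit.
Unset Printing Implicit Defensive.

Import Order.TTheory GRing.Theory Num.Theory.
Import numFieldNormedType.Exports.

Local Open Scope classical_set_scope.
Local Open Scope ring_scope.

Section finite_product.
Context d1 d2 (T1 : measurableType d1) (T2 : measurableType d2) (R : realType).
Variables (m1 : {finite_measure set T1 -> \bar R}).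
Variables (m2 : {finite_measure set T2 -> \bar R}).

(* An alias of m1 \x m2 carrying the structure of a finite measure, which is not
   inferred for \x itself. *)
Definition finite_product : set (T1 * T2) -> \bar R := (m1 \x m2)%E.

HB.instance Definition _ := Measure.on finite_product.

Let finite_product_fin_num : fin_num_fun finite_product.
Proof.
apply: lty_fin_num_fun; rewrite -setXTT.
rewrite [ltLHS](product_measure1E m1 m2 measurableT measurableT).
by rewrite lte_mul_pinfty// ?fin_num_measure// ltey_eq fin_num_measure.
Qed.

HB.instance Definition _ :=
  @Measure_isFinite.Build _ _ _ finite_product finite_product_fin_num.

End finite_product.

Section measures.
Variable R : realType.

Lemma lebesgue_measure_itvcc_lty (a b : R) :
  (@lebesgue_measure R `[a, b]%classic < +oo)%E.
Proof. by rewrite lebesgue_measure_itv /=; case: ifP => // _; rewrite ltry. Qed.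

(* Lebesgue measure on [a, b], as a finite measure on R that vanishes outside
   [a, b]. *)
Definition lebesgue_on (a b : R) :
    {finite_measure set (measurableTypeR R) -> \bar R} :=
  @mfrestr _ (measurableTypeR R) R _ _ (measurable_itv `[a, b])
    (lebesgue_measure_itvcc_lty a b).

Definition mu_time : {finite_measure set (measurableTypeR R) -> \bar R} :=
  lebesgue_on 0 1.

(* A function on the torus T^2 is represented by a function on R * R, of which
   only the values on the fundamental domain [0, sqrt 2] * [0, 1] matter. *)
Definition mu_torus : {finite_measure set
    (measurableTypeR R * measurableTypeR R)%type -> \bar R} :=
  finite_product (lebesgue_on 0 (Num.sqrt 2)) (lebesgue_on 0 1).

Definition mu_spacetime : {finite_measure set
    (measurableTypeR R * (measurableTypeR R * measurableTypeR R))%type ->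
      \bar R} :=
  finite_product mu_time mu_torus.

End measures.
Arguments mu_time {R}.
Arguments mu_torus {R}.
Arguments mu_spacetime {R}.

Section function_spaces.
Variable R : realType.
Implicit Types (f g : R * R -> R) (w phi : R * (R * R) -> R).

Definition L2norm f : \bar R := 'N[mu_torus]_2%:E[EFin \o f]%E.

(* Elements of the Bochner space L^p([0, 1], X) are represented by functions of
   (t, x); here t |-> |w(t, .)|_X is integrated over [0, 1]. *)
Definition time_norm (p : \bar R) (normX : (R * R -> R) -> \bar R) w : \bar R :=
  Lnorm mu_time p (fun t => normX (fun x => w (t, x))).

Definition LpL2 (p : \bar R) : set (R * (R * R) -> R) :=
  [set w | measurable_fun
      [set: measurableTypeR R * (measurableTypeR R * measurableTypeR R)] w /\
    (time_norm p L2norm w < +oo)%E].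

(* Weak-* convergence in L^oo([0, 1], L^2), as the dual of L^1([0, 1], L^2). *)
Definition weak_star_cvg (w : nat -> R * (R * R) -> R)
    (wlim : R * (R * R) -> R) : Prop :=
  forall g : R * (R * R) -> R, LpL2 1%E g ->
    (\int[mu_spacetime]_p (w j p * g p)) @[j --> \oo]
      --> \int[mu_spacetime]_p (wlim p * g p).

(* The wave vector 2 pi (k_1 / sqrt 2, k_2) of the k-th Fourier mode. *)
Definition wave (k : int * int) : R * R :=
  (2 * pi * k.1%:~R / Num.sqrt 2, 2 * pi * k.2%:~R).

Definition phase (k : int * int) (x : R * R) : R :=
  (wave k).1 * x.1 + (wave k).2 * x.2.

(* |T^2|^-1 times the integral of f(x) exp (- i wave k . x). *)
Definition fourier f (k : int * int) : R[i] :=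
  ((Num.sqrt 2)^-1 * \int[mu_torus]_x (f x * cos (phase k x)) +i*
   (- ((Num.sqrt 2)^-1 * \int[mu_torus]_x (f x * sin (phase k x)))))%C.

(* The eigenvalue of - Laplacian on the k-th Fourier mode. *)
Definition eigenval (k : int * int) : R := (wave k).1 ^+ 2 + (wave k).2 ^+ 2.

(* g = (- Laplacian)^(s / 2) f. For s > 0 the mode k = 0 is annihilated, since
   0 `^ (s / 2) = 0. *)
Definition is_frac_laplacian (s : R) f g : Prop :=
  forall k, fourier g k = (eigenval k `^ (s / 2))%:C%C * fourier f k.

(* The infimum is over the representatives of (- Laplacian)^(s / 2) f, which all
   have the same norm; it is +oo if there is none in L^2. *)
Definition Hsnorm (s : R) f : \bar R :=
  ereal_inf [set L2norm g | g in
    [set g | g \in Lfun mu_torus 2%:E /\ is_frac_laplacian s f g]].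

End function_spaces.

Section advection_diffusion.
Variable R : realType.
Implicit Types (phi w : R * (R * R) -> R) (u : R * (R * R) -> R * R).

Definition e_t : R * (R * R) := (1, (0, 0)).
Definition e_x : R * (R * R) := (0, (1, 0)).
Definition e_y : R * (R * R) := (0, (0, 1)).

(* All iterated partial derivatives exist and are continuous. *)
Definition smooth phi : Prop :=
  forall vs : seq (R * (R * R)), {subset vs <= [:: e_t; e_x; e_y]} ->
    let psi := foldr (fun v h => 'D_v h) phi vs in
    continuous psi /\
    forall p v, v \in [:: e_t; e_x; e_y] -> derivable psi p v.

Definition torus_periodic phi : Prop :=
  forall t x y, phi (t, (x + Num.sqrt 2, y)) = phi (t, (x, y)) /\
                phi (t, (x, y + 1)) = phi (t, (x, y)).

(* Test functions on [0, 1) * T^2: the values at negative times are irrelevant,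
   phi need not vanish at t = 0. *)
Definition test_fun_init phi : Prop :=
  [/\ smooth phi, torus_periodic phi &
      exists2 b : R, b < 1 & forall t x, b <= t -> phi (t, x) = 0].

(* Test functions on (0, 1) * T^2. *)
Definition test_fun phi : Prop :=
  test_fun_init phi /\
  exists2 a : R, 0 < a & forall t x, t <= a -> phi (t, x) = 0.

Definition Linfty_field u : Prop :=
  fst \o u \in Lfun mu_spacetime +oo%E /\ snd \o u \in Lfun mu_spacetime +oo%E.

Definition advect u phi (p : R * (R * R)) : R :=
  (u p).1 * 'D_e_x phi p + (u p).2 * 'D_e_y phi p.

Definition laplacian phi (p : R * (R * R)) : R :=
  'D_e_x ('D_e_x phi) p + 'D_e_y ('D_e_y phi) p.

(* In the sense of distributions on (0, 1) * T^2. *)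
Definition divergence_free u : Prop :=
  forall phi, test_fun phi -> \int[mu_spacetime]_p (advect u phi p) = 0.

(* w is the weak solution, in L^oo([0, 1], L^2), of
     d_t w - kappa Laplacian w + u . grad w = 0,  w(0, .) = w0
   for a divergence-free u, so that u . grad w = div (u w). For bounded u this
   distributional solution is unique, and it lies in L^2([0, 1], H^1). *)
Definition solves (u : R * (R * R) -> R * R) (kappa : R) (w0 : R * R -> R)
    (w : R * (R * R) -> R) : Prop :=
  LpL2 +oo%E w /\
  forall phi, test_fun_init phi ->
    \int[mu_spacetime]_p
      (w p * ('D_e_t phi p + kappa * laplacian phi p + advect u phi p))
    + \int[mu_torus]_x (w0 x * phi (0, x)) = 0.

Definition energy (w : R * (R * R) -> R) (t : R) : \bar R :=
  (L2norm (fun x => w (t, x)) ^+ 2)%E.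

End advection_diffusion.

(* Main.v *)
Require Import Defs.
From mathcomp Require Import all_boot all_order all_algebra.
From mathcomp Require Import all_classical all_reals all_analysis.
From mathcomp Require Import measurable_realfun ess_sup_inf.
From mathcomp Require Import complex ring lra zify.

Set Implicit Arguments.
Unset Strict Implicit.
Unset Printing Implicit Defensive.

Import Order.TTheory GRing.Theory Num.Theory.
Import numFieldNormedType.Exports.

Local Open Scope classical_set_scope.
Local Open Scope ring_scope.

(** Suppose that the norms in L^oo([0, 1], H^s) do not tend to infinity: they are
    then bounded by some M along a subsequence, and the energy of the weak limit
    theta turns out to agree almost everywhere with a continuous function.

    As kappa tends to zero the viscous term disappears from the weak formulation,
    so that theta is a distributional solution of the transport equation
    ([limit_equation]).  Tested against products of a function of time and a
    Fourier mode, this equation says that each Fourier coefficient of theta(t, .)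
    has an integrable derivative in t, hence agrees almost everywhere with a
    continuous function F_i ([mode_continuous]).

    On the other hand, Bessel's inequality turns the bound in H^s into a bound,
    uniform in N, on the sum of lambda_i^s a_i^2 over the frequencies of size at
    most N, where the a_i are the Fourier coefficients of the solution and the
    lambda_i the eigenvalues of minus the Laplacian ([sobolev_sum_le]).  Such a
    sum is lower semicontinuous under weak convergence, and the F_i are
    continuous, so that the same bound holds for the F_i(t) at every t in [0, 1]
    ([sobolev_sum_lsc]).  The frequencies larger than N thus contribute
    O(N^-s) to the sum of the F_i(t)^2, uniformly in t: this sum converges
    uniformly, to a continuous function ([energy_limit]).  By Parseval's identity
    ([parseval_sqint]) it is, up to a constant factor, the energy of theta at
    almost every t.

    The Fourier system is used in real form: the modes are the cosines and sines
    of all frequencies.  As k and - k give the same pair of modes up to sign, they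
    are not a basis but a tight frame ([mode_frame]), for which Bessel's
    inequality and Parseval's identity are derived.  Completeness comes from a
    sigma-algebra argument: the sets whose indicator function is a limit in L^1 of
    trigonometric polynomials with values in [0, 1] form a sigma-algebra, stable
    under changes on null sets, which contains the positivity sets of the waves
    and hence all strips. *)

(** * Square-integrable functions and tight frames *)

Section square_integrable.
Context d (T : measurableType d) (R : realType).
Variable mu : {finite_measure set T -> \bar R}.
Implicit Types f g h : T -> R.

(** Real square-integrable functions, as plain functions rather than classes. *)
Definition sqint f : Prop := measurable_fun setT f /\
  mu.-integrable setT (EFin \o (fun x => f x ^+ 2)).

(** The inner product of L^2. *)
Definition ip f g : R := \int[mu]_x (f x * g x).

Lemma sqintM_integrable f g : sqint f -> sqint g ->
  mu.-integrable setT (EFin \o (fun x => f x * g x)).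
Proof.
move=> [mf f2] [mg g2].
apply: (le_integrable measurableT _ _ (integrableD measurableT f2 g2)).
  exact/measurable_EFinP/measurable_funM.
move=> x _ /=; rewrite lee_fin.
have := sqr_ge0 (f x - g x); have := sqr_ge0 (f x + g x).
rewrite (ger0_norm (addr_ge0 (sqr_ge0 (f x)) (sqr_ge0 (g x)))).
by rewrite ler_norml; nra.
Qed.

Lemma sqint_bounded f (C : R) : measurable_fun setT f ->
  (forall x, `|f x| <= C) -> sqint f.
Proof.
move=> mf fC; split => //.
apply: measurable_bounded_integrable => //.
- by rewrite ltey_eq fin_num_measure.
- exact: measurable_funX.
- exists (C ^+ 2); split; first exact: num_real.
  move=> M CM x _ /=.
  rewrite normrX (le_trans _ (ltW CM))// lerXn2r ?nnegrE//.
  by rewrite (le_trans _ (fC x)).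
Qed.

Lemma sqint_cst (c : R) : sqint (cst c).
Proof. exact: (@sqint_bounded _ `|c|). Qed.

Lemma sqint_integrable f : sqint f -> mu.-integrable setT (EFin \o f).
Proof.
move=> sf; have := sqintM_integrable sf (sqint_cst 1).
by apply: eq_integrable => // x _ /=; rewrite mulr1.
Qed.

Lemma sqintD f g : sqint f -> sqint g -> sqint (fun x => f x + g x).
Proof.
move=> sf sg; have fg := sqintM_integrable sf sg.
case: sf sg => mf f2 [mg g2]; split; first exact: measurable_funD.
have := integrableD measurableT (integrableD measurableT f2 g2)
  (integrableD measurableT fg fg).
apply: eq_integrable => // x _ /=; rewrite -!EFinD; congr EFin; ring.
Qed.

Lemma sqintZ (c : R) f : sqint f -> sqint (fun x => c * f x).
Proof.
case=> mf f2; split; first exact: measurable_funM.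
have := integrableZl measurableT (c ^+ 2) f2.
by apply: eq_integrable => // x _ /=; rewrite -EFinM exprMn.
Qed.

Lemma sqintB f g : sqint f -> sqint g -> sqint (fun x => f x - g x).
Proof.
move=> sf sg; have := sqintD sf (sqintZ (-1) sg).
by congr sqint; apply/funext => x; rewrite mulN1r.
Qed.

Lemma sqint_sum (I : Type) (s : seq I) (c : I -> R) (e : I -> T -> R) :
  (forall i, sqint (e i)) -> sqint (fun x => \sum_(i <- s) c i * e i x).
Proof.
move=> se; elim: s => [|i s IH].
  by under eq_fun do rewrite big_nil; exact: sqint_cst.
by under eq_fun do rewrite big_cons; exact: sqintD (sqintZ _ (se i)) IH.
Qed.

Lemma ipC f g : ip f g = ip g f.
Proof. by apply: eq_Rintegral => x _; rewrite mulrC. Qed.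

Lemma ipDl f g h : sqint f -> sqint g -> sqint h ->
  ip (fun x => f x + g x) h = ip f h + ip g h.
Proof.
move=> sf sg sh; rewrite /ip -RintegralD//; try exact: sqintM_integrable.
by apply: eq_Rintegral => x _; rewrite mulrDl.
Qed.

Lemma ipZl (c : R) f g : sqint f -> sqint g ->
  ip (fun x => c * f x) g = c * ip f g.
Proof.
move=> sf sg; rewrite /ip -RintegralZl//; last exact: sqintM_integrable.
by apply: eq_Rintegral => x _; rewrite mulrA.
Qed.

Lemma ipBl f g h : sqint f -> sqint g -> sqint h ->
  ip (fun x => f x - g x) h = ip f h - ip g h.
Proof.
move=> sf sg sh; rewrite /ip -RintegralB//; try exact: sqintM_integrable.
by apply: eq_Rintegral => x _; rewrite mulrBl.
Qed.

Lemma ip_suml (I : Type) (s : seq I) (c : I -> R) (e : I -> T -> R) h :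
  (forall i, sqint (e i)) -> sqint h ->
  ip (fun x => \sum_(i <- s) c i * e i x) h = \sum_(i <- s) c i * ip (e i) h.
Proof.
move=> se sh; elim: s => [|i s IH].
  rewrite big_nil; under [X in ip X]eq_fun do rewrite big_nil.
  rewrite /ip; under eq_Rintegral do rewrite mul0r.
  by rewrite Rintegral_cst// mul0r.
rewrite big_cons -IH; under [X in ip X]eq_fun do rewrite big_cons.
rewrite ipDl//; first by rewrite ipZl.
- exact: sqintZ.
- exact: sqint_sum.
Qed.

Lemma ip_ge0 f : 0 <= ip f f.
Proof. by apply: Rintegral_ge0 => x _; rewrite -expr2 sqr_ge0. Qed.

Lemma ipE_parallelogram f g : sqint f -> sqint g ->
  ip (fun x => f x + g x) (fun x => f x + g x) +
  ip (fun x => f x - g x) (fun x => f x - g x) = 2 * ip f f + 2 * ip g g.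
Proof.
move=> sf sg; have sD := sqintD sf sg; have sB := sqintB sf sg.
rewrite (ipDl sf sg sD) (ipBl sf sg sB).
rewrite !(ipC _ (fun x => f x + g x)) !(ipC _ (fun x => f x - g x)).
rewrite (ipDl sf sg sf) (ipDl sf sg sg) (ipBl sf sg sf) (ipBl sf sg sg).
by rewrite (ipC g f); ring.
Qed.

Lemma Lfun2_sqint f : f \in Lfun mu 2%:E -> sqint f.
Proof.
move=> /[dup] f2 /Lfun2_integrable_sqr; split => //.
by move: f2; rewrite inE => /andP[/[!inE]].
Qed.

Lemma sqint_Lnorm2 f : sqint f ->
  ('N[mu]_2%:E[EFin \o f])%E = (Num.sqrt (ip f f))%:E.
Proof.
move=> [mf f2].
have -> : ('N[mu]_2%:E[EFin \o f])%E =
    ((\int[mu]_x (f x ^+ 2)%:E) `^ (2^-1))%E.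
  rewrite unlock; congr (_ `^ _)%E; apply: eq_integral => x _ /=.
  by rewrite (powR_mulrn 2) // real_normK// num_real.
rewrite -(@fineK _ (\int[mu]_x (f x ^+ 2)%:E)%E); last first.
  exact: integrable_fin_num.
rewrite poweR_EFin; congr EFin.
rewrite -powR12_sqrt ?ip_ge0//.
Qed.

End square_integrable.

Lemma sqint_finite_Lnorm2 d (T : measurableType d) (R : realType)
    (mu : {finite_measure set T -> \bar R}) (f : T -> R) :
  measurable_fun setT f -> ('N[mu]_2%:E[EFin \o f] < +oo)%E -> sqint mu f.
Proof.
by move=> mf f2; apply: Lfun2_sqint; rewrite inE; apply/andP; rewrite !inE.
Qed.

Section frame.
Context d (T : measurableType d) (R : realType).
Variable mu : {finite_measure set T -> \bar R}.
Variables (I : eqType) (s : seq I) (e : I -> T -> R) (c : R).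
Hypothesis c0 : 0 < c.
Hypothesis se : forall i, sqint mu (e i).
Implicit Types f g h : T -> R.

(** When the e_i, i in s, form a tight frame of constant c of their span, this is
    the square of the distance from f to that span. *)
Definition residual f : R := ip mu f f - c^-1 * \sum_(i <- s) ip mu f (e i) ^+ 2.

Lemma residual_le f : residual f <= ip mu f f.
Proof.
rewrite /residual lerBlDr lerDl mulr_ge0 ?invr_ge0 ?(ltW c0)//.
by apply: sumr_ge0 => i _; exact: sqr_ge0.
Qed.

Lemma residualZ (a : R) f : sqint mu f ->
  residual (fun x => a * f x) = a ^+ 2 * residual f.
Proof.
move=> sf; rewrite /residual mulrBr; congr (_ - _).
  by rewrite (ipZl a sf (sqintZ a sf)) ipC ipZl// mulrA expr2.
rewrite [RHS]mulrCA; congr (_ * _); rewrite big_distrr/=.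
by apply: eq_bigr => i _; rewrite ipZl// exprMn.
Qed.

Lemma residual_parallelogram f g : sqint mu f -> sqint mu g ->
  residual (fun x => f x + g x) + residual (fun x => f x - g x) =
  2 * residual f + 2 * residual g.
Proof.
move=> sf sg; rewrite /residual.
have := ipE_parallelogram sf sg.
have : \sum_(i <- s) ip mu (fun x => f x + g x) (e i) ^+ 2 +
       \sum_(i <- s) ip mu (fun x => f x - g x) (e i) ^+ 2 =
       2 * (\sum_(i <- s) ip mu f (e i) ^+ 2) +
       2 * (\sum_(i <- s) ip mu g (e i) ^+ 2).
  rewrite !big_distrr -!big_split/=; apply: eq_bigr => i _.
  by rewrite ipDl// ipBl//; ring.
set A := \sum_(i <- s) _; set B := \sum_(i <- s) _.
set C := \sum_(i <- s) _; set D := \sum_(i <- s) _ => h1 h2.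
have -> : forall a b p q : R, a - c^-1 * p + (b - c^-1 * q) =
  (a + b) - c^-1 * (p + q) by move=> *; ring.
by rewrite h1 h2; ring.
Qed.

(* The operator g |-> sum_l <g, e_l> e_l is c times the orthogonal projection
   onto the span of the e_i. *)
Hypothesis frame : forall g i, sqint mu g -> i \in s ->
  \sum_(l <- s) ip mu g (e l) * ip mu (e i) (e l) = c * ip mu g (e i).

Lemma residual_frame i : i \in s -> residual (e i) = 0.
Proof.
move=> si; rewrite /residual; under eq_bigr do rewrite expr2.
by rewrite frame// mulrA mulVf ?mul1r ?subrr// gt_eqF.
Qed.

Lemma residual_ge0 f : sqint mu f -> 0 <= residual f.
Proof.
move=> sf.
(* The residual is the squared norm of f - P, with P the projection of f. *)
pose P x := \sum_(i <- s) (c^-1 * ip mu f (e i)) * e i x.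
have sP : sqint mu P by exact: sqint_sum.
have := ip_ge0 mu (fun x => f x - P x).
rewrite (ipBl sf sP (sqintB sf sP)) !(ipC _ _ (fun x => f x - P x)).
rewrite (ipBl sf sP sf) (ipBl sf sP sP) (ipC _ f P).
have PE h : sqint mu h -> ip mu P h = c^-1 * \sum_(i <- s) ip mu f (e i) * ip mu h (e i).
  move=> sh; rewrite /P ip_suml// big_distrr/=; apply: eq_bigr => i _.
  by rewrite (ipC _ h) mulrA.
rewrite (PE f sf) (PE P sP).
have -> : \sum_(i <- s) ip mu f (e i) * ip mu P (e i) =
    \sum_(i <- s) ip mu f (e i) * ip mu f (e i).
  rewrite big_seq [RHS]big_seq; apply: eq_bigr => i si.
  by rewrite (PE _ (se i)) frame// mulKf// gt_eqF.
rewrite /residual; under [X in _ -> 0 <= _ - _ * X]eq_bigr do rewrite expr2.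
lra.
Qed.

Lemma bessel f : sqint mu f ->
  \sum_(i <- s) ip mu f (e i) ^+ 2 <= c * ip mu f f.
Proof.
move=> sf; have := residual_ge0 sf.
by rewrite /residual subr_ge0 mulrC ler_pdivrMr// mulrC.
Qed.

Lemma residualD_le f g : sqint mu f -> sqint mu g ->
  residual (fun x => f x + g x) <= 2 * residual f + 2 * residual g.
Proof.
move=> sf sg; rewrite -residual_parallelogram// lerDl.
exact: residual_ge0 (sqintB sf sg).
Qed.

End frame.

(** * Restricted measures and iterated integrals *)

Section restricted_measure.
Context d (T : measurableType d) (R : realType).
Variables (mu : {measure set T -> \bar R}) (D : set T) (mD : measurable D).
Hypothesis muD : (mu D < +oo)%E.

(** The measure [mfrestr mD muD] lives on the whole type and vanishes outside
    D. *)
Lemma integral_mfrestr (f : T -> \bar R) :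
  (mfrestr mD muD).-integrable setT f ->
  (\int[mfrestr mD muD]_x f x = \int[mu]_(x in D) f x)%E.
Proof.
move=> fi; have DN : (mfrestr mD muD) (~` D) = 0%E.
  by rewrite /mfrestr /mrestr setICl measure0.
rewrite (negligible_integral (measurableC mD) measurableT fi DN).
rewrite setTD setCK.
apply: eq_measure_integral => A mA AD.
by rewrite [LHS]/(mu (A `&` D)) setIidl.
Qed.

Lemma ae_mfrestr (P : T -> Prop) :
  {ae mu, forall x, D x -> P x} -> {ae mfrestr mD muD, forall x, P x}.
Proof.
move=> [N [mN N0 DP]]; exists (N `|` ~` D); split.
- exact: measurableU (measurableC mD).
- rewrite /mfrestr /mrestr setIUl setICl setU0.
  apply: (subset_measure0 (measurableI _ _ mN mD) mN _ N0) => x [] //.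
- move=> x Px; have [Dx|nDx] := pselect (D x); last by right.
  by left; apply: DP => /= /(_ Dx).
Qed.

End restricted_measure.

Section fubini.
Context d1 d2 (T1 : measurableType d1) (T2 : measurableType d2) (R : realType).
Variables (m1 : {finite_measure set T1 -> \bar R}).
Variables (m2 : {finite_measure set T2 -> \bar R}).
Local Notation m12 := (finite_product m1 m2).
Variable f : T1 * T2 -> R.
Hypothesis fi : m12.-integrable setT (EFin \o f).

(* The same integrability, for the product measure itself. *)
Let fi' : (m1 \x m2)%E.-integrable setT (EFin \o f).
Proof. exact: fi. Qed.

Lemma ae_integrable_section :
  {ae m1, forall x, m2.-integrable setT (EFin \o (fun y => f (x, y)))}.
Proof. exact: (ae_integrable1 fi'). Qed.

Lemma fubini_fine x : m2.-integrable setT (EFin \o (fun y => f (x, y))) ->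
  (\int[m2]_y f (x, y))%:E = fubini_F m2 (EFin \o f) x.
Proof.
move=> fx; rewrite /Rintegral fineK//.
by rewrite fin_num_abs; have /integrableP[mf] := fx; apply: le_lt_trans;
  exact: le_abse_integral.
Qed.

Lemma measurable_Rintegral_section :
  measurable_fun setT (fun x => \int[m2]_y f (x, y)).
Proof.
have := measurable_fubini_F fi'.
exact: (measurableT_comp (fine_measurable measurableT)).
Qed.

Lemma integrable_Rintegral_section :
  m1.-integrable setT (EFin \o (fun x => \int[m2]_y f (x, y))).
Proof.
have /integrableP[mF Fi] := integrable_fubini_F fi'.
apply/integrableP; split.
  exact/measurable_EFinP/measurable_Rintegral_section.
apply: le_lt_trans Fi; apply: ge0_le_integral => //.
- exact/measurableT_comp/measurable_EFinP/measurable_Rintegral_section.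
- exact: measurableT_comp.
- move=> x _ /=; rewrite /Rintegral /fubini_F /=.
  by case: (\int[m2]_y (f (x, y))%:E)%E => [r||]//=; rewrite ?leey.
Qed.

Lemma fubini_Rintegral :
  \int[m12]_p f p = \int[m1]_x \int[m2]_y f (x, y).
Proof.
rewrite {1}/Rintegral -[X in fine X](integral12_prod_meas1 fi') /Rintegral.
congr fine; apply: ae_eq_integral => //.
- exact: measurable_fubini_F fi'.
- exact/measurable_EFinP/measurable_Rintegral_section.
- by apply: filterS ae_integrable_section => x fx _; rewrite /= fubini_fine.
Qed.

End fubini.

(** * The trigonometric system *)

Section trigonometric_system.
Variable R : realType.
Local Notation mT := (measurableTypeR R).

Lemma cosD2pi_int (x : R) (m : int) : cos (x + 2 * pi * m%:~R) = cos x.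
Proof.
have nat_case (n : nat) (y : R) : cos (y + 2 * pi * n%:R) = cos y.
  elim: n => [|n IH]; first by rewrite mulr0 addr0.
  by rewrite -[RHS]IH -[RHS]cosD2pi; congr cos; rewrite -natr1 mulr2n; ring.
case: (intP m) => [|n|n]; first by rewrite mulr0 addr0.
- exact: nat_case.
- rewrite -[LHS](nat_case n.+1); congr cos.
  by rewrite mulrNz; ring.
Qed.

Lemma sinD2pi_int (x : R) (m : int) : sin (x + 2 * pi * m%:~R) = sin x.
Proof.
by rewrite -!cosBpihalf -[RHS](cosD2pi_int _ m); congr cos; ring.
Qed.

Lemma is_derive_sin_affine (a c t : R) :
  is_derive t 1 (fun t => sin (a * t + c)) (a * cos (a * t + c)).
Proof.
have h : is_derive t 1 (fun t : R => a * t + c) a.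
  by apply: is_derive_eq; rewrite addr0 /GRing.scale/= mulr1.
rewrite mulrC; exact: (@is_derive1_comp _ sin (fun t : R => a * t + c)).
Qed.

Lemma is_derive_cos_affine (a c t : R) :
  is_derive t 1 (fun t => cos (a * t + c)) (- a * sin (a * t + c)).
Proof.
have h : is_derive t 1 (fun t : R => a * t + c) a.
  by apply: is_derive_eq; rewrite addr0 /GRing.scale/= mulr1.
rewrite mulNr mulrC -mulNr.
exact: (@is_derive1_comp _ cos (fun t : R => a * t + c)).
Qed.

Lemma continuous_cos_affine (a c : R) : continuous (fun t => cos (a * t + c)).
Proof.
move=> t; apply: differentiable_continuous; apply/derivable1_diffP.
exact: (@ex_derive _ _ _ _ _ _ _ (is_derive_cos_affine a c t)).
Qed.

Lemma continuous_sin_affine (a c : R) : continuous (fun t => sin (a * t + c)).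
Proof.
move=> t; apply: differentiable_continuous; apply/derivable1_diffP.
exact: (@ex_derive _ _ _ _ _ _ _ (is_derive_sin_affine a c t)).
Qed.

Lemma lebesgue_on_setT (a b : R) : a <= b ->
  lebesgue_on a b setT = (b - a)%:E.
Proof.
move=> ab; rewrite /lebesgue_on [LHS]/(lebesgue_measure (setT `&` `[a, b])).
rewrite setTI [LHS](@lebesgue_measure_itv R `[a, b]) /= lte_fin.
by move: ab; rewrite le_eqVlt => /predU1P[->|->//]; rewrite ltxx subrr.
Qed.

Lemma Rintegral_lebesgue_on (a b : R) (f : R -> R) :
  (lebesgue_on a b).-integrable setT (EFin \o f) ->
  \int[lebesgue_on a b]_x f x = \int[lebesgue_measure]_(x in `[a, b]) f x.
Proof. by move=> fi; rewrite /Rintegral integral_mfrestr. Qed.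

Lemma integral_cos_period (L b c : R) (m : int) : 0 < L -> m != 0 ->
  b * L = 2 * pi * m%:~R ->
  \int[lebesgue_on 0 L]_x cos (b * x + c) = 0.
Proof.
move=> L0 m0 bL; have b0 : b != 0.
  apply: contra_neq m0 => b0; move: bL; rewrite b0 mul0r => /esym/eqP.
  rewrite !mulf_eq0 pnatr_eq0/= gt_eqF ?pi_gt0//= intr_eq0.
  by move/eqP.
have cc := @continuous_cos_affine b c.
rewrite Rintegral_lebesgue_on; last first.
  apply: measurable_bounded_integrable => //.
  - by rewrite ltey_eq fin_num_measure.
  - exact: continuous_measurable_fun.
  - exists 1; split; first exact: num_real.
    move=> M M1 x _ /=; rewrite (le_trans _ (ltW M1))//.
    by rewrite ler_norml cos_geN1 cos_le1.
rewrite /Rintegral.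
have dF (x : R) : is_derive x 1 (fun x => b^-1 * sin (b * x + c)) (cos (b * x + c)).
  have h := is_derive_sin_affine b c x.
  by apply: is_derive_eq; rewrite /GRing.scale/= mulKf.
have cF : continuous (fun x => b^-1 * sin (b * x + c) : R).
  by move=> x; apply: cvgM; [exact: cvg_cst|exact: continuous_sin_affine].
rewrite [X in fine X](@continuous_FTC2 _ _ (fun x => b^-1 * sin (b * x + c)) 0 L) //.
- by rewrite mulr0 add0r bL (addrC _ c) sinD2pi_int subee.
- exact: continuous_subspaceT.
- split.
  + by move=> x _; exact: (@ex_derive _ _ _ _ _ _ _ (dF x)).
  + by apply: cvg_at_right_filter; exact: cF.
  + by apply: cvg_at_left_filter; exact: cF.
- by move=> x _; rewrite derive1E; exact: (@derive_val _ _ _ _ _ _ _ (dF x)).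
Qed.

(** The plane wave of frequency k and phase shift al. *)
Definition tw (k : int * int) (al : R) (x : R * R) : R := cos (phase k x + al).

Lemma normr_tw k al x : `|tw k al x| <= 1.
Proof. by rewrite ler_norml cos_geN1 cos_le1. Qed.

Lemma measurable_phase k : measurable_fun [set: mT * mT] (@phase R k).
Proof.
by apply: measurable_funD; apply: measurable_funM.
Qed.

Lemma measurable_tw k al : measurable_fun [set: mT * mT] (tw k al).
Proof.
apply: (@measurableT_comp _ _ _ _ _ _ (@cos R)).
  exact: continuous_measurable_fun (@continuous_cos R).
by apply: measurable_funD => //; exact: measurable_phase.
Qed.

Lemma sqint_tw k al : sqint mu_torus (tw k al).
Proof. by apply: sqint_bounded; [exact: measurable_tw|exact: normr_tw]. Qed.

Lemma sqrt2_gt0 : 0 < Num.sqrt 2 :> R. Proof. by rewrite sqrtr_gt0. Qed.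

Lemma wave1_sqrt2 k : (@wave R k).1 * Num.sqrt 2 = 2 * pi * k.1%:~R.
Proof. by rewrite /wave/= divfK// gt_eqF// sqrt2_gt0. Qed.

Lemma integral_tw k al :
  \int[mu_torus]_x tw k al x = if k == 0 then Num.sqrt 2 * cos al else 0.
Proof.
rewrite fubini_Rintegral; last exact: (sqint_integrable (sqint_tw k al)).
case: k => k1 k2; rewrite /tw /phase xpair_eqE.
have [->|k20] := eqVneq k2 0; last first.
  rewrite andbF; under eq_Rintegral => x _.
    under eq_Rintegral => y _ do rewrite /= addrAC addrC.
    rewrite (@integral_cos_period 1 _ _ k2)//; last by rewrite mulr1.
    over.
  by rewrite Rintegral_cst// mul0r.
under eq_Rintegral => x _.
  under eq_Rintegral => y _ do rewrite /= !(mulr0, mul0r, addr0).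
  rewrite Rintegral_cst// [X in _ * fine X]lebesgue_on_setT// subr0 mulr1.
  over.
rewrite andbT; have [->|k10] := eqVneq k1 0.
  under eq_Rintegral => x _ do rewrite /= !(mulr0, mul0r, add0r).
  rewrite Rintegral_cst// [X in _ * fine X]lebesgue_on_setT ?sqrtr_ge0//.
  by rewrite subr0 mulrC.
rewrite (@integral_cos_period _ _ _ k1)//.
exact: (wave1_sqrt2 (k1, 0)).
Qed.

Lemma phaseD k l x : phase (k + l) x = @phase R k x + phase l x.
Proof. by rewrite /phase /wave/= !intrD; ring. Qed.

Lemma phaseN k x : phase (- k) x = - @phase R k x.
Proof. by rewrite /phase /wave/= !mulrNz; ring. Qed.

(** Product-to-sum formula: the waves span an algebra. *)
Lemma tw_mul k al l be x : tw k al x * tw l be x =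
  2^-1 * tw (k + l) (al + be) x + 2^-1 * tw (k - l) (al - be) x.
Proof.
rewrite /tw !phaseD phaseN.
have -> : phase k x + phase l x + (al + be) = (phase k x + al) + (phase l x + be).
  by ring.
have -> : phase k x - phase l x + (al - be) = (phase k x + al) - (phase l x + be).
  by ring.
by move: (phase k x + al) (phase l x + be) => a b; rewrite cosD cosB; field.
Qed.

Lemma ip_tw k al l be : ip mu_torus (tw k al) (tw l be) =
  Num.sqrt 2 / 2 * ((k == l)%:R * cos (al - be) + (k == - l)%:R * cos (al + be)).
Proof.
rewrite /ip; under eq_Rintegral do rewrite tw_mul.
have it k' al' : mu_torus.-integrable setT (EFin \o (tw k' al')).
  exact: (sqint_integrable (sqint_tw k' al')).
have it2 k' al' : mu_torus.-integrable setT (EFin \o (fun x => 2^-1 * tw k' al' x)).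
  exact: (integrableZl measurableT _ (it k' al')).
rewrite RintegralD//; try exact: it2.
rewrite !RintegralZl//; try exact: it.
rewrite !integral_tw subr_eq0 addr_eq0.
by case: (k == l); case: (k == - l); rewrite /=; field.
Qed.

(** The real Fourier modes: (k, true) stands for cos (phase k x), and (k, false)
    for sin (phase k x). *)
Definition mode (i : (int * int) * bool) : R * R -> R :=
  tw i.1 (if i.2 then 0 else - (pi / 2)).

Lemma mode_cos k : mode (k, true) = fun x => cos (phase k x).
Proof. by apply/funext => x; rewrite /mode /tw/= addr0. Qed.

Lemma mode_sin k : mode (k, false) = fun x => sin (phase k x).
Proof. by apply/funext => x; rewrite /mode /tw/= cosBpihalf. Qed.

Lemma sqint_mode i : sqint mu_torus (mode i).
Proof. exact: sqint_tw. Qed.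

Definition freqs1 (N : nat) : seq int := [seq i%:Z - N%:Z | i <- iota 0 N.*2.+1].

(** The frequencies of size at most N, for the sup norm. *)
Definition freqs (N : nat) : seq (int * int) :=
  [seq (i, j) | i <- freqs1 N, j <- freqs1 N].

(** The modes over these frequencies. *)
Definition modes (N : nat) : seq ((int * int) * bool) :=
  [seq (k, b) | k <- freqs N, b <- [:: true; false]].

Lemma mem_freqs1 N i : (i \in freqs1 N) = (`|i| <= N%:Z).
Proof.
apply/mapP/idP => [[j]|iN].
  by rewrite mem_iota => /andP[_ jN] ->; lia.
by exists `|(i + N%:Z)%R|%N; rewrite ?mem_iota; lia.
Qed.

Lemma uniq_freqs1 N : uniq (freqs1 N).
Proof. by rewrite map_inj_uniq ?iota_uniq// => i j; lia. Qed.

Lemma mem_freqs N k : (k \in freqs N) = (`|k.1| <= N%:Z) && (`|k.2| <= N%:Z).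
Proof.
case: k => i j; rewrite /freqs -!mem_freqs1.
apply/allpairsP/andP => [[[a b] /= [ia jb [-> ->]]]//|[ia jb]].
by exists (i, j).
Qed.

Lemma uniq_freqs N : uniq (freqs N).
Proof.
by apply: allpairs_uniq; rewrite ?uniq_freqs1// => -[a b] [c e] _ _ /= [-> ->].
Qed.

Lemma freqsN N k : (- k \in freqs N) = (k \in freqs N).
Proof. by rewrite !mem_freqs /= !normrN. Qed.

Lemma mem_modes N i : (i \in modes N) = (i.1 \in freqs N).
Proof.
case: i => k b; apply/allpairsP/idP => [[[a c] /= [ka _ [-> _]]]//|kN].
by exists (k, b); split => //=; case: (b); rewrite !inE.
Qed.

Lemma sum_modes N (F : (int * int) * bool -> R) :
  \sum_(i <- modes N) F i = \sum_(k <- freqs N) (F (k, true) + F (k, false)).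
Proof.
rewrite /modes big_allpairs; apply: eq_bigr => k _.
by rewrite !big_cons big_nil; exact: (congr1 _ (addr0 _)).
Qed.

Lemma uniq_modes N : uniq (modes N).
Proof. by apply: allpairs_uniq; rewrite ?uniq_freqs// => -[a b] [c e] _ _ /= [-> ->]. Qed.

Lemma sub_modes N M : (N <= M)%N -> {subset modes N <= modes M}.
Proof.
move=> NM i; rewrite !mem_modes !mem_freqs => /andP[h1 h2].
by rewrite (le_trans h1)/= ?(le_trans h2)// lez_nat.
Qed.

Lemma sum_modes_split N M (f : (int * int) * bool -> R) : (N <= M)%N ->
  \sum_(i <- modes M) f i =
  \sum_(i <- modes N) f i + \sum_(i <- modes M | i \notin modes N) f i.
Proof.
move=> NM; rewrite (bigID (mem (modes N)))/=; congr (_ + _).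
rewrite -big_filter; apply: perm_big.
apply: uniq_perm; rewrite ?filter_uniq ?uniq_modes// => i.
by rewrite mem_filter andb_idr//; exact: sub_modes.
Qed.

Lemma sum_delta (I : eqType) (m : I) (r : seq I) (F : I -> R) :
  uniq r -> m \in r -> \sum_(l <- r) (l == m)%:R * F l = F m.
Proof.
move=> u mN; rewrite (bigD1_seq m)//= big1 ?addr0 ?eqxx ?mul1r//.
by move=> l /negPf ->; rewrite mul0r.
Qed.

(** The modes form a tight frame of constant sqrt 2, the area of the torus: for
    k <> 0 a mode has squared norm (sqrt 2) / 2, but it is counted twice, as k and
    as - k; for k = 0 the cosine has squared norm sqrt 2, and the sine vanishes. *)
Lemma mode_frame N g i : sqint mu_torus g -> i \in modes N ->
  \sum_(l <- modes N) ip mu_torus g (mode l) * ip mu_torus (mode i) (mode l)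
  = Num.sqrt 2 * ip mu_torus g (mode i).
Proof.
move=> sg; rewrite mem_modes sum_modes; case: i => k b /= kN.
have negmode b' : ip mu_torus g (mode (- k, b')) =
    (if b' then 1 else -1) * ip mu_torus g (mode (k, b')).
  rewrite -ipC -[in RHS]ipC -ipZl//; last exact: sqint_mode.
  congr ip; apply/funext => x; case: b'.
    by rewrite !mode_cos phaseN cosN mul1r.
  by rewrite !mode_sin phaseN sinN mulN1r.
have ipm b1 b2 l : ip mu_torus (mode (k, b1)) (mode (l, b2)) =
    Num.sqrt 2 / 2 * ((l == k)%:R * (b1 == b2)%:R +
      (l == - k)%:R * ((b1 == b2)%:R * (if b1 then 1 else -1))).
  have kl : (k == - l) = (l == - k) by rewrite -addr_eq0 addrC addr_eq0.
  rewrite /mode ip_tw (eq_sym k) kl /=.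
  have pp : - (pi / 2) - (pi / 2) = - pi :> R by field.
  by case: b1; case: b2; rewrite /= ?(subr0, addr0, sub0r, add0r, oppr0, subrr, opprK)
    ?pp ?cosN ?cos0 ?cos_pihalf ?cospi ?mul1r ?mul0r ?mulr1 ?mulr0.
have E (G H : int * int -> R) : \sum_(l <- freqs N)
    ((l == k)%:R * G l + (l == - k)%:R * H l) = G k + H (- k).
  by rewrite big_split/= !sum_delta ?uniq_freqs ?freqsN.
rewrite (eq_bigr (fun l =>
  (l == k)%:R * (Num.sqrt 2 / 2 * ip mu_torus g (mode (l, b))) +
  (l == - k)%:R * (Num.sqrt 2 / 2 * ((if b then 1 else -1) *
    ip mu_torus g (mode (l, b)))))); last first.
  by move=> l _; rewrite !ipm; case: (b) => /=; ring.
by rewrite E negmode; case: b => /=; field.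
Qed.

End trigonometric_system.

(** * Density of trigonometric polynomials *)

Section dominated.
Context d (T : measurableType d) (R : realType).
Variable mu : {measure set T -> \bar R}.

Lemma Rintegral_dominated_cvg (f_ : nat -> T -> R) (f g : T -> R) :
  (forall n, measurable_fun setT (f_ n)) -> measurable_fun setT f ->
  {ae mu, forall x, f_ n x @[n --> \oo] --> f x} ->
  mu.-integrable setT (EFin \o g) ->
  {ae mu, forall x, forall n, `|f_ n x| <= g x} ->
  \int[mu]_x f_ n x @[n --> \oo] --> \int[mu]_x f x.
Proof.
move=> mf_ mf ff ig fg.
have [] := @dominated_convergence _ _ _ mu setT measurableT
  (fun n => EFin \o f_ n) (EFin \o f) (EFin \o g).
- by move=> n; exact/measurable_EFinP.
- exact/measurable_EFinP.
- apply: filterS ff => x fx _.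
  by apply: cvg_EFin; [exact: nearW|exact: fx].
- exact: ig.
- by apply: filterS fg => x fx n _ /=; rewrite lee_fin.
move=> fi _ h; apply: fine_cvg.
by rewrite fineK//; exact: integrable_fin_num.
Qed.

End dominated.

Section bernoulli.
Variable R : realType.

Lemma ler_bernoulli (z : R) n : -1 <= z -> 1 + z *+ n <= (1 + z) ^+ n.
Proof.
move=> z1; elim: n => [|n IH]; first by rewrite mulr0n addr0 expr0.
rewrite exprS mulrS; apply: le_trans (ler_wpM2l _ IH); last by lra.
have := sqr_ge0 z; rewrite -mulr_natr => z2; have : 0 <= n%:R :> R by [].
by nra.
Qed.

(** Polynomials with values in [0, 1] on [0, 1], that converge to the indicator
    function of y > 1/2 at every y <> 1/2. *)
Definition step_poly (n : nat) (y : R) : R := 1 - (1 - y ^+ n) ^+ (2 ^ n).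

Lemma step_poly_itv n y : 0 <= y <= 1 -> 0 <= step_poly n y <= 1.
Proof.
move=> /andP[y0 y1]; rewrite /step_poly subr_ge0 gerBl.
have yn1 : y ^+ n <= 1 by rewrite exprn_ile1.
rewrite exprn_ge0 ?subr_ge0// andbT.
by rewrite exprn_ile1 ?subr_ge0// gerBl exprn_ge0.
Qed.

Lemma step_poly_cvg y : 0 <= y <= 1 -> y != 2^-1 ->
  step_poly n y @[n --> \oo] --> ((2^-1 < y)%R%:R : R).
Proof.
move=> y01 yh; have /andP[y0 y1] := y01.
have E n : (2 * y) ^+ n = y ^+ n *+ (2 ^ n)%N.
  by rewrite exprMn -[RHS]mulr_natl natrX.
have [yl|yg|yE] := ltgtP y (2^-1); last by rewrite yE eqxx in yh.
(* For y < 1/2, Bernoulli's inequality bounds step_poly by (2 y)^n. *)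
- apply: (@squeeze_cvgr _ _ _ _ (fun=> 0) (fun n => (2 * y) ^+ n)).
  + near=> n; have /andP[-> _] := step_poly_itv n y01.
    rewrite E /step_poly lerBlDr -lerBlDl -mulNrn.
    apply: ler_bernoulli; rewrite lerN2.
    by rewrite exprn_ile1.
  + exact: cvg_cst.
  + by apply: cvg_expr; rewrite ger0_norm; lra.
(* For y > 1/2, it bounds (1 - y^n)^(2^n) (1 + (2 y)^n) by
   ((1 - y^n) (1 + y^n))^(2^n), which is at most 1. *)
- have yp : 0 < y by lra.
  have c : 1 - ((2 * y)^-1) ^+ n @[n --> \oo] --> (1 : R).
    rewrite -[X in _ --> X]subr0; apply: cvgB; first exact: cvg_cst.
    apply: cvg_expr; rewrite ger0_norm ?invr_ge0; last by lra.
    by rewrite invf_lt1; lra.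
  apply: (squeeze_cvgr _ c (@cvg_cst _ (1 : R) _ _ _)).
  near=> n; have /andP[_ ->] := step_poly_itv n y01; rewrite andbT.
  rewrite /step_poly lerD2l lerN2 exprVn -div1r ler_pdivlMr; last first.
    by rewrite exprn_gt0//; lra.
  have yn0 : 0 <= y ^+ n by exact: exprn_ge0.
  have yn1 : y ^+ n <= 1 by rewrite exprn_ile1.
  apply: (@le_trans _ _ ((1 - y ^+ n) ^+ (2 ^ n) * (1 + y ^+ n) ^+ (2 ^ n))).
    apply: ler_wpM2l; first by rewrite exprn_ge0// subr_ge0.
    rewrite E; apply: le_trans (ler_bernoulli _ _); last by lra.
    by rewrite lerDr.
  rewrite -exprMn exprn_ile1//; first by nra.
  by nra.
Unshelve. all: by end_near. Qed.

End bernoulli.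

Section trigonometric_polynomials.
Variable R : realType.
Local Notation mT := (measurableTypeR R).
Local Notation T2 := (mT * mT)%type.
Local Notation mu := (@mu_torus R).
Implicit Types (P Q : R * R -> R) (A B : set T2).

(** Real trigonometric polynomials on the torus. *)
Inductive trigpoly : (R * R -> R) -> Prop :=
| trigpoly0 : trigpoly (fun=> 0)
| trigpolyS c k al P : trigpoly P -> trigpoly (fun x => c * tw k al x + P x).

Lemma trigpolyD P Q : trigpoly P -> trigpoly Q -> trigpoly (fun x => P x + Q x).
Proof.
move=> tP tQ; elim: tP => [|c k al {}P _ IH].
  by under eq_fun do rewrite add0r.
by under eq_fun do rewrite -addrA; exact: trigpolyS.
Qed.

Lemma trigpolyZ (a : R) P : trigpoly P -> trigpoly (fun x => a * P x).
Proof.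
elim=> [|c k al {}P _ IH].
  by under eq_fun do rewrite mulr0; exact: trigpoly0.
by under eq_fun do rewrite mulrDr mulrA; exact: trigpolyS.
Qed.

Lemma trigpoly_tw k al : trigpoly (tw k al).
Proof.
have := trigpolyS 1 k al trigpoly0.
by congr trigpoly; apply/funext => x; rewrite mul1r addr0.
Qed.

Lemma trigpoly_cst (a : R) : trigpoly (fun=> a).
Proof.
have := trigpolyZ a (trigpoly_tw 0 0); congr trigpoly; apply/funext => x.
by rewrite /tw /phase /wave/= !(mulr0, mul0r, addr0, cos0) mulr1.
Qed.

Lemma trigpolyM P Q : trigpoly P -> trigpoly Q -> trigpoly (fun x => P x * Q x).
Proof.
move=> tP tQ; elim: tP => [|c k al {}P _ IH].
  by under eq_fun do rewrite mul0r; exact: trigpoly0.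
under eq_fun do rewrite mulrDl; apply: trigpolyD IH.
elim: tQ => [|c' k' al' {}Q _ IH].
  by under eq_fun do rewrite mulr0; exact: trigpoly0.
under eq_fun do rewrite mulrDr; apply: trigpolyD IH.
have := trigpolyZ (c * c') (trigpolyD (trigpolyZ 2^-1 (trigpoly_tw (k + k') (al + al')))
  (trigpolyZ 2^-1 (trigpoly_tw (k - k') (al - al')))).
congr trigpoly; apply/funext => x.
by rewrite -tw_mul; ring.
Qed.

Lemma trigpolyX P n : trigpoly P -> trigpoly (fun x => P x ^+ n).
Proof.
move=> tP; elim: n => [|n IH].
  by under eq_fun do rewrite expr0; exact: trigpoly_cst.
by under eq_fun do rewrite exprS; exact: trigpolyM.
Qed.

Lemma trigpoly1B P : trigpoly P -> trigpoly (fun x => 1 - P x).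
Proof.
move=> /(trigpolyZ (-1)) /(trigpolyD (trigpoly_cst 1)).
by congr trigpoly; apply/funext => x; rewrite mulN1r.
Qed.

Lemma trigpoly_step n P : trigpoly P -> trigpoly (fun x => step_poly n (P x)).
Proof.
move=> tP; apply: (trigpoly1B (P := fun x => (1 - P x ^+ n) ^+ (2 ^ n))).
apply: (trigpolyX (P := fun x => 1 - P x ^+ n)).
exact: trigpoly1B (trigpolyX n tP).
Qed.

Lemma measurable_trigpoly P : trigpoly P -> measurable_fun [set: T2] P.
Proof.
elim=> [|c k al {}P _ IH]; first exact: measurable_cst.
apply: measurable_funD => //; apply: measurable_funM => //.
exact: measurable_tw.
Qed.

(** The measurable sets whose indicator function is a limit in L^1 of trigonometric
    polynomials with values in [0, 1]. *)
Definition approx A : Prop := measurable A /\ forall e : R, 0 < e ->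
  exists P, [/\ trigpoly P, forall x, 0 <= P x <= 1 &
    \int[mu]_x `|\1_A x - P x| <= e].

Lemma integrable_unit_dist (f g : T2 -> R) : measurable_fun setT f ->
  measurable_fun setT g -> (forall x, 0 <= f x <= 1) -> (forall x, 0 <= g x <= 1) ->
  mu.-integrable setT (EFin \o (fun x => `|f x - g x|)).
Proof.
move=> mf mg f01 g01; apply: (@sqint_integrable _ _ _ mu (fun x => `|f x - g x|)).
apply: (@sqint_bounded _ _ _ _ _ 1).
  by apply: measurableT_comp => //; exact: measurable_funB.
move=> x; rewrite normr_id ler_norml.
by have /andP[? ?] := f01 x; have /andP[? ?] := g01 x; apply/andP; split; lra.
Qed.

Lemma indic_itv A x : 0 <= (\1_A x : R) <= 1.
Proof. by rewrite indicE; case: (_ \in _); rewrite lexx ler01. Qed.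

Lemma approx0 : approx set0.
Proof.
split => // e e0; exists (fun=> 0); split; first exact: trigpoly0.
  by move=> x; rewrite lexx ler01.
under eq_Rintegral do rewrite indic0 /cst subrr normr0.
by rewrite Rintegral_cst// mul0r ltW.
Qed.

Lemma approxC A : approx A -> approx (~` A).
Proof.
move=> [mA apA]; split; first exact: measurableC.
move=> e /apA[P [tP P01 Pe]]; exists (fun x => 1 - P x); split.
- exact: trigpoly1B.
- by move=> x; have /andP[? ?] := P01 x; apply/andP; split; lra.
- apply: le_trans Pe; rewrite le_eqVlt; apply/orP; left; apply/eqP.
  apply: eq_Rintegral => x _; rewrite -normrN; congr Num.norm.
  by rewrite !indicE in_setC; case: (_ \in _) => /=; ring.
Qed.

Lemma approxI A B : approx A -> approx B -> approx (A `&` B).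
Proof.
move=> [mA apA] [mB apB]; split; first exact: measurableI.
move=> e e0; have e2 : 0 < e / 2 by rewrite divr_gt0.
have [P [tP P01 Pe]] := apA _ e2; have [Q [tQ Q01 Qe]] := apB _ e2.
exists (fun x => P x * Q x); split; first exact: trigpolyM.
- move=> x; have /andP[? ?] := P01 x; have /andP[? ?] := Q01 x.
  by apply/andP; split; nra.
- have iA := integrable_unit_dist (measurable_indic mA) (measurable_trigpoly tP)
    (indic_itv A) P01.
  have iB := integrable_unit_dist (measurable_indic mB) (measurable_trigpoly tQ)
    (indic_itv B) Q01.
  rewrite [leRHS]splitr; apply: le_trans (lerD Pe Qe).
  rewrite -RintegralD//; apply: le_Rintegral => //.
  + apply: integrable_unit_dist.
    * exact/measurable_indic/measurableI.
    * by apply: measurable_funM; exact: measurable_trigpoly.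
    * exact: indic_itv.
    * move=> x; have /andP[? ?] := P01 x; have /andP[? ?] := Q01 x.
      by apply/andP; split; nra.
  + exact: integrableD iA iB.
  + move=> x _; rewrite indicI.
    have -> : \1_A x * \1_B x - P x * Q x =
        Q x * (\1_A x - P x) + \1_A x * (\1_B x - Q x) :> R by ring.
    apply: le_trans (ler_normD _ _) _; rewrite !normrM; apply: lerD.
      have /andP[q0 q1] := Q01 x.
      by rewrite ger0_norm// ler_piMl.
    have /andP[a0 a1] := indic_itv A x.
    by rewrite (ger0_norm a0) ler_piMl.
Qed.

Lemma approxU A B : approx A -> approx B -> approx (A `|` B).
Proof.
move=> aA aB; rewrite -[X in approx X]setCK setCU.
by apply: approxC; apply: approxI; exact: approxC.
Qed.

Lemma approx_cvg A (f : nat -> T2 -> R) : measurable A ->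
  (forall n, measurable_fun setT (f n)) -> (forall n x, 0 <= f n x <= 1) ->
  {ae mu, forall x, f n x @[n --> \oo] --> (\1_A x : R)} ->
  \int[mu]_x `|\1_A x - f n x| @[n --> \oo] --> (0 : R).
Proof.
move=> mA mf f01 fA.
have -> : 0 = \int[mu]_x (cst 0 x) :> R by rewrite Rintegral_cst// mul0r.
apply: (@Rintegral_dominated_cvg _ _ _ _ _ _ (cst 1)).
- move=> n; apply: measurableT_comp => //; exact: measurable_funB.
- exact: measurable_cst.
- apply: filterS fA => x fx; rewrite /cst -(normr0 R) -(subrr (\1_A x : R)).
  by apply: cvg_norm; apply: cvgB => //; exact: cvg_cst.
- exact: finite_measure_integrable_cst.
- apply: nearW => x n; rewrite normr_id ler_norml /cst.
  have /andP[? ?] := f01 n x; have /andP[? ?] := indic_itv A x.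
  by apply/andP; split; lra.
Qed.

Lemma approx_bigcup (F : (set T2)^nat) : (forall n, approx (F n)) ->
  approx (\bigcup_n F n).
Proof.
move=> aF; pose G n := \big[setU/set0]_(i < n.+1) F i.
have aG n : approx (G n).
  rewrite /G; elim: n.+1 => [|m IH]; first by rewrite big_ord0; exact: approx0.
  by rewrite big_ord_recr/=; exact: approxU.
have mUF : measurable (\bigcup_n F n).
  by apply: bigcupT_measurable => n; have [] := aF n.
split=> // e e0.
have : \int[mu]_x `|\1_(\bigcup_n F n) x - \1_(G n) x| @[n --> \oo] --> (0 : R).
  apply: approx_cvg => //.
  - by move=> n; apply: measurable_indic; have [] := aG n.
  - by move=> n x; exact: indic_itv.
  - apply: nearW => x; rewrite indicE; apply: cvg_near_cst.
    have [/set_mem[m _ Fmx]|/negP nFx] := boolP (x \in \bigcup_n F n).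
      exists m => //= n mn; rewrite indicE mem_set// /G.
      rewrite -bigcup_mkord; exists m => //=.
    apply: nearW => n; rewrite indicE memNset// => Gx; apply: nFx.
    move: Gx; rewrite /G -bigcup_mkord => -[m _ Fm]; apply/mem_set.
    by exists m.
have e2 : 0 < e / 2 by rewrite divr_gt0.
move=> /cvgrPdist_le /(_ _ e2)[m _ /(_ m (leqnn m))]; rewrite sub0r normrN.
rewrite ger0_norm; last by apply: Rintegral_ge0.
move=> he; have [mG /(_ _ e2)[P [tP P01 Pe]]] := aG m.
exists P; split => //.
have i1 := integrable_unit_dist (measurable_indic mUF) (measurable_indic mG)
  (indic_itv _) (indic_itv _).
have i2 := integrable_unit_dist (measurable_indic mG) (measurable_trigpoly tP)
  (indic_itv _) P01.
have i3 := integrable_unit_dist (measurable_indic mUF) (measurable_trigpoly tP)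
  (indic_itv _) P01.
rewrite [leRHS]splitr; apply: le_trans (lerD he Pe).
rewrite -RintegralD//; apply: le_Rintegral => //.
- exact: integrableD i1 i2.
- move=> x _; exact: ler_distD.
Qed.

(** Sets that differ by a null set are approximable together. *)
Lemma approx_ae A B : measurable A -> approx B ->
  {ae mu, forall x, A x <-> B x} -> approx A.
Proof.
move=> mA [mB aB] AB; split => // e /aB[P [tP P01 Pe]]; exists P; split => //.
have i1 := integrable_unit_dist (measurable_indic mA) (measurable_trigpoly tP)
  (indic_itv _) P01.
have i2 := integrable_unit_dist (measurable_indic mB) (measurable_trigpoly tP)
  (indic_itv _) P01.
apply: le_trans Pe; rewrite le_eqVlt; apply/orP; left; apply/eqP.
congr fine; apply: ae_eq_integral => //.
- exact: measurable_int i1.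
- exact: measurable_int i2.
- apply: filterS AB => x AB _ /=.
  have -> : \1_A x = \1_B x :> R; last by [].
  by rewrite !indicE (_ : (x \in A) = (x \in B))//; apply/idP/idP => /set_mem/AB/mem_set.
Qed.

(** The polynomials [step_poly] are composed with (1 + tw k al) / 2, which exceeds
    1/2 exactly where the wave is positive. *)
Lemma approx_wave_pos k al (S := tw k al : T2 -> R) : {ae mu, forall x, S x != 0} ->
  approx [set x | 0 < S x].
Proof.
move=> S0; have mA : measurable [set x : T2 | 0 < S x].
  rewrite -[X in measurable X]setTI.
  have := @measurable_fun_ltr _ _ _ setT (cst 0) S (measurable_cst _) (measurable_tw k al).
  by move=> /(_ measurableT [set true] I); rewrite setTI.
pose y x := 2^-1 * S x + 2^-1.
have ty : trigpoly y.
  exact: trigpolyD (trigpolyZ _ (trigpoly_tw k al)) (trigpoly_cst _).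
have y01 x : 0 <= y x <= 1.
  have := normr_tw k al x; rewrite ler_norml /y -/(S x) => /andP[? ?].
  by apply/andP; split; lra.
split => // e e0.
have : \int[mu]_x `|\1_([set x | 0 < S x]) x - step_poly n (y x)| @[n --> \oo] --> (0 : R).
  apply: (@approx_cvg _ (fun n x => step_poly n (y x))) => //.
  - by move=> n; exact: measurable_trigpoly (trigpoly_step n ty).
  - by move=> n x; exact: (step_poly_itv n (y01 x)).
  - apply: filterS S0 => x Sx0.
    have -> : \1_([set x | 0 < S x]) x = (2^-1 < y x)%R%:R :> R.
      rewrite indicE (_ : (x \in _) = (2^-1 < y x)%R)//.
      apply/idP/idP => [/set_mem/= h|h]; first by rewrite /y; lra.
      by apply/mem_set => /=; move: h; rewrite /y; lra.
    apply: step_poly_cvg; first exact: y01.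
    apply: contra_neq Sx0; rewrite /y; lra.
move=> /cvgrPdist_le /(_ _ e0)[m _ /(_ m (leqnn m))]; rewrite sub0r normrN.
rewrite ger0_norm; last by apply: Rintegral_ge0.
move=> he; exists (fun x => step_poly m (y x)); split => //.
- exact: (trigpoly_step m ty).
- by move=> x; exact: (step_poly_itv m (y01 x)).
Qed.

End trigonometric_polynomials.

Section coordinate_sets.
Variable R : realType.
Local Notation mT := (measurableTypeR R).
Local Notation T2 := (mT * mT)%type.
Local Notation mu := (@mu_torus R).

Section sign_of_sine.
Variable L : R.
Hypothesis L0 : 0 < L.

Let angle (v : R) := 2 * pi * v / L.

Let sin_pos v : 0 < v < L / 2 -> 0 < sin (angle v).
Proof.
move=> /andP[v0 vL]; apply: sin_gt0_pi; rewrite /angle; apply/andP; split.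
  by rewrite divr_gt0// !mulr_gt0// pi_gt0.
rewrite ltr_pdivrMr// (mulrC 2) -mulrA ltr_pM2l ?pi_gt0//; lra.
Qed.

Let sinDL v : sin (angle (v + L)) = sin (angle v).
Proof.
rewrite -[RHS](sinD2pi_int _ 1) /angle; congr sin.
by field; rewrite gt_eqF.
Qed.

Lemma sin_gt0_period v : - L < v < L -> v != 0 -> v != L / 2 -> v != - (L / 2) ->
  sin (2 * pi * v / L) != 0 /\
  (0 < sin (2 * pi * v / L) <-> (0 < v /\ v < L / 2) \/ v < - (L / 2)).
Proof.
move=> /andP[vl vL] v0 vh vh'; rewrite -/(angle v).
have neg w : - (L / 2) < w < 0 -> sin (angle w) < 0.
  move=> /andP[w1 w2]; have -> : angle w = - angle (- w).
    by rewrite /angle mulrN mulNr opprK.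
  by rewrite sinN oppr_lt0; apply: sin_pos; apply/andP; split; lra.
have [v1|v1|v1] := ltgtP v 0; last by rewrite v1 eqxx in v0.
- have [v2|v2|v2] := ltgtP v (- (L / 2)); last by rewrite v2 eqxx in vh'.
  + have h : 0 < sin (angle v).
      by rewrite -sinDL; apply: sin_pos; apply/andP; split; lra.
    by split; [rewrite gt_eqF|split => // _; right].
  + have h : sin (angle v) < 0 by apply: neg; rewrite v2.
    split; first by rewrite lt_eqF.
    by split => [/(lt_trans h)|[[]|]]; [rewrite ltxx|lra|lra].
- have [v2|v2|v2] := ltgtP v (L / 2); last by rewrite v2 eqxx in vh.
  + have h : 0 < sin (angle v) by apply: sin_pos; rewrite v1.
    by split; [rewrite gt_eqF|split => // _; left].
  + have h : sin (angle v) < 0.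
      by rewrite -[v](subrK L) sinDL; apply: neg; apply/andP; split; lra.
    split; first by rewrite lt_eqF.
    by split => [/(lt_trans h)|[[]|]]; [rewrite ltxx|lra|lra].
Qed.

End sign_of_sine.

(* Here pr is one of the two coordinates, of period L, and kk the corresponding
   fundamental frequency. *)
Variables (pr : T2 -> R) (L : R) (kk : int * int).
Hypothesis mpr : measurable_fun setT pr.
Hypothesis L0 : 0 < L.
Hypothesis phase_kk : forall x, phase kk x = 2 * pi * pr x / L.
Hypothesis pr_itv : {ae mu, forall x, 0 <= pr x <= L}.
Hypothesis pr_neq : forall c, {ae mu, forall x, pr x != c}.

(* The sine wave in the coordinate pr that vanishes at a. *)
Let S a : T2 -> R := tw kk (- (2 * pi * a / L) - pi / 2).

Let SE a x : S a x = sin (2 * pi * (pr x - a) / L).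
Proof.
rewrite /S /tw phase_kk -cosBpihalf; congr cos.
by field; rewrite gt_eqF.
Qed.

(* On a period, the wave is positive on the half-period that follows a, taken
   modulo L. *)
Let ae_sign a : 0 <= a < L -> {ae mu, forall x, [/\ S a x != 0,
  (0 < S a x <-> (0 < pr x - a /\ pr x - a < L / 2) \/ pr x - a < - (L / 2)),
  0 < pr x < L & pr x != a]}.
Proof.
move=> /andP[a0 aL].
have n1 : {ae mu, forall x, [/\ pr x != a, pr x != a + L / 2 & pr x != a - L / 2]}.
  by apply: filterS3 (pr_neq a) (pr_neq (a + L / 2)) (pr_neq (a - L / 2)) => x.
have n2 : {ae mu, forall x, [/\ pr x != 0, pr x != L & 0 <= pr x <= L]}.
  by apply: filterS3 (pr_neq 0) (pr_neq L) pr_itv => x.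
apply: filterS2 n1 n2 => x [h3 h2 h1] [h5 h4 /andP[h6 h7]].
have xL : 0 < pr x < L by rewrite !lt_neqAle eq_sym h5 h6 h4 h7.
have /andP[x0 x1] := xL.
have [] := @sin_gt0_period _ L0 (pr x - a); rewrite ?subr_eq0//.
- by apply/andP; split; lra.
- by rewrite subr_eq addrC.
- by rewrite subr_eq addrC.
- by rewrite SE.
Qed.

Let approx_S a : 0 <= a < L -> approx [set x | 0 < S a x].
Proof.
by move=> aL; apply: approx_wave_pos; apply: filterS (ae_sign aL) => x [].
Qed.

(* For 0 < b < L, the strip 0 < pr < b is S 0 > 0 >= S b if b <= L / 2, and the
   union of S 0 > 0 and S b <= 0 otherwise, up to null sets. *)
Let approx_ray b : approx (pr @^-1` `]-oo, b[).
Proof.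
have mA : measurable (pr @^-1` `]-oo, b[).
  by rewrite -[X in measurable X]setTI; apply: mpr => //; exact: measurable_itv.
have rayE x : (pr @^-1` `]-oo, b[) x <-> pr x < b by rewrite /= in_itv.
have [b0|b0] := leP b 0.
  apply: (approx_ae mA (approx0 R)); apply: filterS pr_itv => x /andP[x0 _].
  by split => // /rayE xb; have := lt_le_trans xb b0; rewrite ltNge x0.
have [bL|bL] := leP L b.
  apply: (approx_ae mA (approxC (approx0 R))); apply: filterS2 pr_itv (pr_neq L).
  move=> x /andP[_ xL] xL'; rewrite rayE; split => [_ []|_].
  by rewrite (lt_le_trans _ bL)// lt_neqAle xL'.
have b0L : 0 <= b < L by rewrite ltW.
have L00 : 0 <= (0 : R) < L by rewrite lexx.
have hb := ae_sign b0L; have h0 := ae_sign L00.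
have [bh|bh] := leP b (L / 2).
- apply: (approx_ae mA (approxI (approx_S L00) (approxC (approx_S b0L)))).
  apply: filterS2 hb h0 => x [_ hb /andP[x0 xL] xb] [_ h0 _ _].
  rewrite rayE; split => [xltb|[/= /h0 s0 sb]].
    split; first by apply/h0; left; split; lra.
    by move=> /= /hb; lra.
  rewrite ltNge; apply/negP => bx; apply: sb; apply/hb; left.
  have : b < pr x by rewrite lt_neqAle eq_sym xb.
  by lra.
- apply: (approx_ae mA (approxU (approx_S L00) (approxC (approx_S b0L)))).
  apply: filterS2 hb h0 => x [_ hb /andP[x0 xL] xb] [_ h0 _ _].
  rewrite rayE; split => [xltb|[/= /h0 s0|/= sb]].
  + have [xh|xh] := ltP (pr x) (L / 2); first by left; apply/h0; left; split; lra.
    by right => /= /hb; lra.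
  + lra.
  + rewrite ltNge; apply/negP => bx; apply: sb; apply/hb; left.
    have : b < pr x by rewrite lt_neqAle eq_sym xb.
    by lra.
Qed.

Lemma approx_coordinate (B : set mT) : measurable B -> approx (pr @^-1` B).
Proof.
suff : @measurable _ mT `<=` [set B : set mT | approx (pr @^-1` B)] by apply.
rewrite [X in X `<=` _](RGenInftyO.measurableE R).
apply: smallest_sub; last by move=> _ [b ->]; exact: approx_ray.
split; first by rewrite /= preimage_set0; exact: approx0.
- by move=> C /= aC; rewrite setTD preimage_setC; exact: approxC.
- by move=> F /= aF; rewrite preimage_bigcup; exact: approx_bigcup.
Qed.

End coordinate_sets.

Section density.
Variable R : realType.
Local Notation mT := (measurableTypeR R).
Local Notation T2 := (mT * mT)%type.
Local Notation mu := (@mu_torus R).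

Lemma ae_product1 d1 d2 (T1 : measurableType d1) (S2 : measurableType d2)
    (m1 : {finite_measure set T1 -> \bar R}) (m2 : {finite_measure set S2 -> \bar R})
    (P : T1 -> Prop) :
  {ae m1, forall x, P x} -> {ae finite_product m1 m2, forall x, P x.1}.
Proof.
move=> [N [mN N0 PN]]; exists (N `*` setT); split.
- exact: measurableX.
- rewrite [LHS](product_measure1E m1 m2 mN measurableT).
  by rewrite -[X in X = _]/(m1 N * m2 setT)%E N0 mul0e.
- by move=> [x y] /= Px; split => //; exact: PN.
Qed.

Lemma ae_product2 d1 d2 (T1 : measurableType d1) (S2 : measurableType d2)
    (m1 : {finite_measure set T1 -> \bar R}) (m2 : {finite_measure set S2 -> \bar R})
    (P : S2 -> Prop) :
  {ae m2, forall x, P x} -> {ae finite_product m1 m2, forall x, P x.2}.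
Proof.
move=> [N [mN N0 PN]]; exists (setT `*` N); split.
- exact: measurableX.
- rewrite [LHS](product_measure1E m1 m2 measurableT mN).
  by rewrite -[X in X = _]/(m1 setT * m2 N)%E N0 mule0.
- by move=> [x y] /= Px; split => //; exact: PN.
Qed.

Lemma ae_lebesgue_on_itv (a b : R) : {ae lebesgue_on a b, forall x, a <= x <= b}.
Proof. by apply: ae_mfrestr; apply: aeW => x; rewrite /= in_itv. Qed.

Lemma ae_lebesgue_on_neq (a b c : R) : {ae lebesgue_on a b, forall x, x != c}.
Proof.
apply: ae_mfrestr; exists [set c]; split => //; first exact: lebesgue_measure_set1.
by move=> x /= h; apply/eqP/negPn/negP => xc; apply: h.
Qed.

(** Every measurable set is approximable: rectangles are intersections of two
    strips, and approximable sets form a sigma-algebra. *)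
Lemma approx_measurable (A : set T2) : measurable A -> approx A.
Proof.
suff : @measurable _ T2 `<=` @approx R by apply.
rewrite measurable_prod_measurableType; apply: smallest_sub; last first.
  move=> _ [B mB [C mC <-]].
  have -> : B `*` C = fst @^-1` B `&` snd @^-1` C by apply/seteqP; split.
  apply: approxI.
  - apply: (@approx_coordinate R fst (Num.sqrt 2) (1, 0)) => //.
    + by move=> x; rewrite /phase /wave/= mulr0 mul0r addr0 mulr1 mulrAC.
    + exact: (ae_product1 _ (ae_lebesgue_on_itv _ _)).
    + by move=> c; exact: (ae_product1 _ (ae_lebesgue_on_neq _ _ c)).
  - apply: (@approx_coordinate R snd 1 (0, 1)) => //.
    + by move=> x; rewrite /phase /wave/= mulr0 !mul0r add0r mulr1 divr1.
    + exact: (ae_product2 _ (ae_lebesgue_on_itv _ _)).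
    + by move=> c; exact: (ae_product2 _ (ae_lebesgue_on_neq _ _ c)).
split; first exact: approx0.
- by move=> C aC; rewrite setTD; exact: approxC.
- by move=> F aF; exact: approx_bigcup.
Qed.

End density.

(** * Parseval's identity *)

Section parseval.
Variable R : realType.
Local Notation mT := (measurableTypeR R).
Local Notation T2 := (mT * mT)%type.
Local Notation mu := (@mu_torus R).
Implicit Types f g : T2 -> R.

(** The part of the squared norm of f not carried by the frequencies of size at
    most N. *)
Definition fourier_residual (N : nat) f : R :=
  residual mu (modes N) (@mode R) (Num.sqrt 2) f.

Lemma fourier_residual_ge0 N f : sqint mu f -> 0 <= fourier_residual N f.
Proof.
move=> sf; apply: residual_ge0 => //.
- exact: sqint_mode.
- by move=> g i sg iN; exact: mode_frame.
Qed.

Lemma fourier_residualD_le N f g : sqint mu f -> sqint mu g ->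
  fourier_residual N (fun x => f x + g x) <=
  2 * fourier_residual N f + 2 * fourier_residual N g.
Proof.
move=> sf sg; apply: residualD_le => //.
- exact: sqint_mode.
- by move=> h i sh iN; exact: mode_frame.
Qed.

(** Parseval's identity for f, as a limit over the partial sums of its Fourier
    series. *)
Definition parseval f : Prop :=
  sqint mu f /\ fourier_residual N f @[N --> \oo] --> (0 : R).

(** The identity passes to limits in L^2. *)
Lemma parseval_closed f : sqint mu f ->
  (forall e : R, 0 < e -> exists2 g, parseval g &
    ip mu (fun x => f x - g x) (fun x => f x - g x) <= e) -> parseval f.
Proof.
move=> sf fg; split => //; apply/cvgrPdist_le => e e0.
have e4 : 0 < e / 4 by rewrite divr_gt0.
have [g [sg /cvgrPdist_le/(_ _ e4) gc] ge] := fg _ e4.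
apply: filterS gc => N; rewrite !sub0r !normrN.
rewrite !ger0_norm ?fourier_residual_ge0// => rg.
have sfg := sqintB sf sg.
have := fourier_residualD_le N sfg sg.
under [X in fourier_residual _ X]eq_fun do rewrite subrK.
have : fourier_residual N (fun x => f x - g x) <= e / 4.
  by apply: le_trans ge; exact: residual_le.
by move=> ? ?; lra.
Qed.

Lemma parsevalD f g : parseval f -> parseval g -> parseval (fun x => f x + g x).
Proof.
move=> [sf cf] [sg cg]; split; first exact: sqintD.
apply: (@squeeze_cvgr _ _ _ _ (fun=> 0)
  (fun N => 2 * fourier_residual N f + 2 * fourier_residual N g)).
- apply: nearW => N; rewrite fourier_residual_ge0/=; last exact: sqintD.
  exact: fourier_residualD_le.
- exact: cvg_cst.
- have -> : 0 = 2 * 0 + 2 * 0 :> R by rewrite mulr0 addr0.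
  by apply: cvgD; (apply: cvgM; [exact: cvg_cst|]).
Qed.

Lemma parsevalZ (a : R) f : parseval f -> parseval (fun x => a * f x).
Proof.
move=> [sf cf]; split; first exact: sqintZ.
have -> : (fun N => fourier_residual N (fun x => a * f x)) =
    (fun N => a ^+ 2 * fourier_residual N f).
  apply/funext => N; rewrite /fourier_residual residualZ//.
  exact: sqint_mode.
rewrite -[X in _ --> X](mulr0 (a ^+ 2)).
by apply: cvgM cf; exact: cvg_cst.
Qed.

(** A mode has no residual as soon as N is at least the size of its frequency. *)
Lemma parseval_mode i : parseval (@mode R i).
Proof.
split; first exact: sqint_mode.
pose m := maxn `|i.1.1|%N `|i.1.2|%N.
apply: cvg_near_cst; exists m => // N mN.
apply: residual_frame => //; first exact: sqint_mode.
- by move=> g l sg lN; exact: mode_frame.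
- rewrite mem_modes mem_freqs; move: mN; rewrite /m/=; lia.
Qed.

Lemma parseval_trigpoly P : trigpoly P -> parseval P.
Proof.
elim=> [|c k al {}P _ IH].
  have := parsevalZ 0 (parseval_mode (0, true)).
  by congr parseval; apply/funext => x; rewrite mul0r.
apply: parsevalD => //; apply: parsevalZ.
have := parsevalD (parsevalZ (cos al) (parseval_mode (k, true)))
  (parsevalZ (- sin al) (parseval_mode (k, false))).
congr parseval; apply/funext => x.
by rewrite mode_cos mode_sin /tw cosD; ring.
Qed.

Lemma parseval_indic (A : set T2) : measurable A -> parseval \1_A.
Proof.
move=> mA; have sA : sqint mu \1_A.
  apply: (@sqint_bounded _ _ _ _ _ 1); first exact: measurable_indic.
  by move=> x; have /andP[? ?] := @indic_itv R A x; rewrite ler_norml; apply/andP; split; lra.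
apply: parseval_closed => // e e0.
have [_ /(_ _ e0)[P [tP P01 Pe]]] := approx_measurable mA.
exists P; first exact: parseval_trigpoly.
have [sP _] := parseval_trigpoly tP.
apply: le_trans Pe; apply: le_Rintegral => //.
- exact: sqintM_integrable (sqintB sA sP) (sqintB sA sP).
- apply: integrable_unit_dist => //.
  + exact: measurable_trigpoly.
  + exact: indic_itv.
- move=> x _; apply: le_trans (ler_norm _) _; rewrite normrM ler_piMl//.
  have /andP[? ?] := @indic_itv R A x; have /andP[? ?] := P01 x.
  by rewrite ler_norml; apply/andP; split; lra.
Qed.

Import HBNNSimple.

Lemma parseval_nnsfun (h : {nnsfun T2 >-> R}) : parseval h.
Proof.
have -> : (h : T2 -> R) = fun x => \sum_(y <- finmap.enum_fset (fset_set (range h)))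
    y * \1_(h @^-1` [set y]) x.
  by apply/funext => x; rewrite [LHS]fimfunE fsbig_finite.
elim: (finmap.enum_fset _) => [|y s IH].
  have := parsevalZ 0 (parseval_mode (0, true)).
  by congr parseval; apply/funext => x; rewrite mul0r big_nil.
under eq_fun do rewrite big_cons.
apply: parsevalD => //; apply: parsevalZ; exact: parseval_indic.
Qed.

Lemma parseval_ge0 f : sqint mu f -> (forall x, 0 <= f x) -> parseval f.
Proof.
move=> sf f0; have [mf f2] := sf; apply: parseval_closed => // e e0.
have mf' : measurable_fun setT (EFin \o f) by exact/measurable_EFinP.
pose g := nnsfun_approx measurableT mf'.
have cg x : g n x @[n --> \oo] --> f x.
  have : (EFin \o g^~ x) n @[n --> \oo] --> (EFin \o f) x.
    by apply: cvg_nnsfun_approx => // y _; rewrite lee_fin.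
  by move=> /fine_cvgP[].
have gf n x : g n x <= f x.
  rewrite -(cvg_lim (@Rhausdorff R) (cg x)).
  apply: (@nondecreasing_cvgn_le _ (fun n => g n x)).
  - by move=> a b ab; exact/lefP/nd_nnsfun_approx.
  - by apply/cvg_ex; exists (f x).
have sg n : sqint mu (g n) by have [] := parseval_nnsfun (g n).
have : ip mu (fun x => f x - g n x) (fun x => f x - g n x) @[n --> \oo] --> (0 : R).
  have -> : 0 = \int[mu]_x (cst 0 x) :> R by rewrite Rintegral_cst// mul0r.
  apply: (@Rintegral_dominated_cvg _ _ _ _ _ _ (fun x => f x ^+ 2)) => //.
  - by move=> n; apply: measurable_funM; apply: measurable_funB => //; have [] := sg n.
  - apply: nearW => x; rewrite /cst -(mulr0 0) -(subrr (f x)).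
    by apply: cvgM; (apply: cvgB; [exact: cvg_cst|exact: cg]).
  - apply: nearW => x n; rewrite -expr2 ger0_norm ?sqr_ge0//.
    have := gf n x; have : 0 <= g n x by exact: fun_ge0.
    by nra.
move=> /cvgrPdist_le /(_ _ e0)[m _ /(_ m (leqnn m))]; rewrite sub0r normrN.
rewrite ger0_norm ?ip_ge0// => he; exists (g m) => //.
exact: parseval_nnsfun.
Qed.

(** The trigonometric system is complete in L^2 of the torus. *)
Theorem parseval_sqint f : sqint mu f -> parseval f.
Proof.
move=> sf; have [mf f2] := sf.
have part (h : T2 -> R) : measurable_fun setT h -> (forall x, 0 <= h x) ->
    (forall x, `|h x| <= `|f x|) -> parseval h.
  move=> mh h0 hf; apply: parseval_ge0 => //; split => //.
  apply: (le_integrable measurableT _ _ f2).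
    exact/measurable_EFinP/measurable_funX.
  move=> x _ /=; rewrite lee_fin !ger0_norm ?sqr_ge0//.
  by rewrite -(real_normK (num_real (f x))) -(real_normK (num_real (h x))) lerXn2r.
have pp : parseval (f ^\+)%R.
  apply: part; [exact: measurable_funrpos|exact: funrpos_ge0|].
  move=> x; rewrite ger0_norm ?funrpos_ge0//.
  by rewrite /funrpos ge_max ler_norm normr_ge0.
have pn : parseval (f ^\-)%R.
  apply: part; [exact: measurable_funrneg|exact: funrneg_ge0|].
  move=> x; rewrite ger0_norm ?funrneg_ge0//.
  by rewrite /funrneg ge_max -normrN ler_norm normr_ge0.
have := parsevalD pp (parsevalZ (-1) pn); congr parseval; apply/funext => x.
by rewrite mulN1r -[in RHS](funrposBneg f).
Qed.

End parseval.

(** * Smooth test functions vanishing after a given time *)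

Section flat_functions.
Variable R : realType.
Implicit Types P : {poly R}.

(** The exponential dominates every polynomial; the factor 1 + z is there to give
    the quadratic bound [flat_le]. *)
Lemma horner_le_exp P : exists2 C : R, 0 < C &
  forall z, 0 <= z -> (1 + z) * `|P.[z]| <= C * expR z.
Proof.
have [C [m [C0 PC]]] : exists C, exists m, 0 <= C /\
    forall z, 0 <= z -> `|P.[z]| <= C * (1 + z) ^+ m.
  elim/poly_ind: P => [|P c [C [m [C0 IH]]]].
    by exists 0, 0%N; split => // z _; rewrite horner0 normr0 mul0r.
  exists (C + `|c|), m.+1; split; first by rewrite addr_ge0.
  move=> z z0; rewrite hornerD hornerM hornerX hornerC mulrDl.
  apply: le_trans (ler_normD _ _) _; apply: lerD.
    rewrite normrM (ger0_norm z0) exprSr mulrA.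
    apply: ler_pM => //; first exact: IH.
    by rewrite lerDr.
  by rewrite ler_peMr// exprn_ege1// lerDl.
exists (C * m.+1%:R ^+ m.+1 + 1) => [|z z0].
  by rewrite ltr_wpDl// mulr_ge0// exprn_ge0.
(* From 1 + w <= exp w at w = z / (m + 1), raised to the power m + 1. *)
have h1 : 1 + z <= m.+1%:R * expR (z / m.+1%:R).
  have := @expR_ge1Dx R (z / m.+1%:R); rewrite -(@ler_pM2l _ m.+1%:R)//.
  apply: le_trans; rewrite mulrDr mulr1 mulrCA divff// mulr1 lerD2r.
  by rewrite ler1n.
have h2 : (1 + z) ^+ m.+1 <= m.+1%:R ^+ m.+1 * expR z.
  have := @lerXn2r _ m.+1 _ _ _ _ h1; rewrite !nnegrE.
  move=> /(_ _ _)/le_trans; apply; rewrite ?addr_ge0 ?mulr_ge0 ?expR_ge0//.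
  by rewrite exprMn -expRM_natl [X in expR X]mulrC divfK.
apply: (@le_trans _ _ (C * (1 + z) ^+ m.+1)).
  by rewrite exprS mulrCA ler_wpM2l ?addr_ge0// PC.
apply: (@le_trans _ _ (C * (m.+1%:R ^+ m.+1 * expR z))); first by rewrite ler_wpM2l.
by rewrite mulrA ler_wpM2r ?expR_ge0// lerDl.
Qed.

Lemma cvg_is_derive (V W : normedModType R) (f : V -> W) (x v : V) (l : W) :
  h^-1 *: ((f \o shift x) (h *: v) - f x) @[h --> (0 : R)^'] --> l ->
  is_derive x v f l.
Proof.
by move=> fl; apply: DeriveDef; [apply/cvg_ex; exists l|exact/cvg_lim].
Qed.

(** The function x P(1/x) exp(-1/x), extended by zero to x <= 0. These functions
    form a class stable under derivation, hence are smooth. *)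
Definition flat P (x : R) : R :=
  if 0 < x then x * P.[x^-1] * expR (- x^-1) else 0.

(** The polynomial associated with the derivative of [flat P]. *)
Definition flat_deriv P : {poly R} := 'X * P - 'X^2 * P^`() + 'X^2 * P.

Lemma flat_le P : exists2 C : R, 0 < C & forall x, `|flat P x| <= C * x ^+ 2.
Proof.
have [C C0 PC] := horner_le_exp P; exists C => // x; rewrite /flat.
case: ifPn => [x0|_]; last by rewrite normr0 mulr_ge0 ?sqr_ge0// ltW.
have z0 : 0 < x^-1 by rewrite invr_gt0.
rewrite !normrM (gtr0_norm x0) (gtr0_norm (expR_gt0 _)) expRN.
rewrite ler_pdivrMr ?expR_gt0//.
have := PC _ (ltW z0); rewrite -(ler_pM2l (exprn_gt0 2 x0)).
rewrite (_ : x ^+ 2 * (C * _) = C * x ^+ 2 * expR x^-1); last by ring.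
apply: le_trans; rewrite mulrA ler_wpM2r//.
by rewrite mulrDr mulr1 expr2 -mulrA divff ?gt_eqF// mulr1 lerDr mulr_ge0 ?ltW.
Qed.

Lemma flatZ (c : R) P x : flat (c *: P) x = c * flat P x.
Proof. by rewrite /flat hornerZ; case: ifP => _; [ring|rewrite mulr0]. Qed.

Lemma is_derive_flat P (x : R) : is_derive x 1 (flat P) (flat (flat_deriv P) x).
Proof.
have [x0|x0|x0] := ltgtP x 0.
- have -> : flat (flat_deriv P) x = 0 by rewrite /flat ltNge ltW.
  have h : is_derive x 1 (cst 0 : R -> R) 0 by exact: is_derive_cst.
  apply: (@near_eq_is_derive _ _ _ (cst 0 : R -> R)) => //.
  near=> y; rewrite /flat/= ifF//; apply/negbTE; rewrite -leNgt; apply: ltW.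
  by near: y; exact: lt_nbhsl.
- have xn0 : x != 0 by rewrite gt_eqF.
  have h : is_derive x 1 (fun x => x * P.[x^-1] * expR (- x^-1)) (flat (flat_deriv P) x).
    have hi : is_derive x 1 (fun x : R => x^-1) (- x ^- 2).
      have := @is_deriveV _ (id : R -> R) x 1 1 xn0 (is_derive_id x 1).
      by rewrite /GRing.scale/= mulr1.
    have hp : is_derive x 1 (fun x => P.[x^-1]) (P^`().[x^-1] * - x ^- 2).
      have := derivableP (@derivable_horner _ P x^-1); rewrite -derive1E -derivE => ?.
      exact: (@is_derive1_comp _ (horner P) (fun x : R => x^-1)).
    have he : is_derive x 1 (fun x : R => expR (- x^-1)) (expR (- x^-1) * x ^- 2).
      have hn : is_derive x 1 (fun x : R => - x^-1) (x ^- 2).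
        by apply: is_derive_eq; rewrite opprK.
      exact: (@is_derive1_comp _ expR (fun x : R => - x^-1)).
    apply: is_derive_eq; rewrite /flat x0 /flat_deriv /GRing.scale/=.
    rewrite !(hornerD, hornerN, hornerM, hornerX, hornerXn).
    by field.
  apply: (near_eq_is_derive _ h).
  near=> y; rewrite /flat ifT//.
  by near: y; exact: lt_nbhsr.
- rewrite x0; have -> : flat (flat_deriv P) 0 = 0 by rewrite /flat ltxx.
  apply: cvg_is_derive; have [C C0 PC] := flat_le P.
  have fl0 : flat P 0 = 0 by rewrite /flat ltxx.
  apply/cvgrPdist_le => e e0; near=> h.
  rewrite sub0r normrN /= fl0 subr0 addr0 [_ *: 1]mulr1 normrM.
  have h0 : h != 0 by near: h; exact: nbhs_dnbhs_neq.
  rewrite normfV ler_pdivrMl ?normr_gt0//; apply: le_trans (PC _) _.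
  rewrite -(real_normK (num_real h)) expr2 mulrA (mulrC _ e).
  apply: ler_wpM2r => //; rewrite -ler_pdivlMl//.
  near: h; apply: dnbhs0_le; rewrite mulr_gt0// invr_gt0//.
Unshelve. all: by end_near. Qed.

End flat_functions.

Section test_functions.
Variable R : realType.
Implicit Types (P : {poly R}) (p : R * (R * R)).

(** The space-time test function flat P (n (a - t)) cos (phase k x + al), which
    vanishes for t >= a. Its partial derivatives are again of this form, with
    another polynomial and another phase shift. *)
Definition wave_test (n a : R) P (k : int * int) (al : R) p : R :=
  flat P (n * (a - p.1)) * tw k al p.2.

Lemma wave_testZ n a c P k al p :
  wave_test n a (c *: P) k al p = c * wave_test n a P k al p.
Proof. by rewrite /wave_test flatZ mulrA. Qed.

Lemma continuous_flat P : continuous (flat P).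
Proof.
move=> x; apply: differentiable_continuous; apply/derivable1_diffP.
exact: (@ex_derive _ _ _ _ _ _ _ (is_derive_flat P x)).
Qed.

Lemma continuous_wave_test n a P k al : continuous (wave_test n a P k al).
Proof.
move=> p; apply: cvgM.
  apply: (@continuous_comp _ _ _ (fun p : R * (R * R) => n * (a - p.1)) (flat P)).
    apply: cvgM; first exact: cvg_cst.
    by apply: cvgB; [exact: cvg_cst|exact: cvg_fst].
  exact: continuous_flat.
apply: (@continuous_comp _ _ _ (fun p : R * (R * R) => phase k p.2 + al) cos).
  apply: cvgD; last exact: cvg_cst.
  apply: cvgD; (apply: cvgM; first exact: cvg_cst).
    apply: (@continuous_comp _ _ _ (snd : R * (R * R) -> _) fst).
      exact: cvg_snd.
    exact: cvg_fst.
  apply: (@continuous_comp _ _ _ (snd : R * (R * R) -> _) snd); exact: cvg_snd.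
exact: continuous_cos.
Qed.

(** Directional derivatives are ordinary derivatives along a line. *)
Lemma is_derive_line (V : normedModType R) (f : V -> R) (v q : V) (l : R) :
  is_derive (0 : R) 1 (fun h => f (h *: v + q)) l -> is_derive q v f l.
Proof.
case=> dv vl; apply: cvg_is_derive.
have := dv => /cvg_ex[l' hl'].
have ll' : l = l' by rewrite -vl; apply/cvg_lim.
rewrite ll'; apply: cvg_trans hl'; apply: near_eq_cvg; apply: nearW => h /=.
by rewrite addr0 [_ *: 1]mulr1 scale0r add0r.
Qed.

Lemma is_derive_wave_test_t n a P k al p :
  is_derive p (e_t R) (wave_test n a P k al)
    (wave_test n a (- n *: flat_deriv P) k al p).
Proof.
apply: is_derive_line => //; rewrite wave_testZ /wave_test /=.
have h1 : is_derive (0 : R) 1 (fun h : R => n * (a - (h *: 1 + p.1))) (- n).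
  have -> : (fun h : R => n * (a - (h *: 1 + p.1))) = (fun h => - n * h + n * (a - p.1)).
    by apply/funext => h; rewrite [_ *: _]mulr1; ring.
  by apply: is_derive_eq; rewrite addr0 /GRing.scale/= mulr1.
have h2 := @is_derive1_comp _ (flat P) _ 0 _ _ (is_derive_flat P _) h1.
have -> : (fun h : R => flat P (n * (a - (h *: 1 + p.1))) *
    tw k al (h *: 0 + p.2.1, h *: 0 + p.2.2)) =
  (fun h : R => tw k al p.2 * (flat P \o (fun h : R => n * (a - (h *: 1 + p.1)))) h).
  by apply/funext => h; rewrite /= !scaler0 !add0r mulrC; case: p {h1 h2} => ? [].
apply: is_derive_eq; rewrite /= scale0r add0r /GRing.scale/=.
by ring.
Qed.

Lemma is_derive_wave_test_x n a P k al p :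
  is_derive p (e_x R) (wave_test n a P k al)
    (wave_test n a ((wave R k).1 *: P) k (al + pi / 2) p).
Proof.
apply: is_derive_line => //; rewrite wave_testZ /wave_test /=.
have h1 := is_derive_cos_affine (wave R k).1 ((wave R k).2 * p.2.2 + al + (wave R k).1 * p.2.1) 0.
have -> : (fun h : R => flat P (n * (a - (h *: 0 + p.1))) *
    tw k al (h *: 1 + p.2.1, h *: 0 + p.2.2)) =
  (fun h : R => flat P (n * (a - p.1)) *
    cos ((wave R k).1 * h + ((wave R k).2 * p.2.2 + al + (wave R k).1 * p.2.1))).
  apply/funext => h; rewrite /= !scaler0 !add0r [_ *: 1]mulr1; congr (_ * _).
  by rewrite /tw /phase /=; congr cos; ring.
apply: is_derive_eq; rewrite /GRing.scale/= mulr0 add0r.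
rewrite /tw [phase k p.2 + _]addrA cosDpihalf /phase /wave/= mulNr.
by rewrite [RHS]mulrCA [in RHS]mulrN; congr (_ * - (_ * sin _)); ring.
Qed.

Lemma is_derive_wave_test_y n a P k al p :
  is_derive p (e_y R) (wave_test n a P k al)
    (wave_test n a ((wave R k).2 *: P) k (al + pi / 2) p).
Proof.
apply: is_derive_line => //; rewrite wave_testZ /wave_test /=.
have h1 := is_derive_cos_affine (wave R k).2 ((wave R k).1 * p.2.1 + al + (wave R k).2 * p.2.2) 0.
have -> : (fun h : R => flat P (n * (a - (h *: 0 + p.1))) *
    tw k al (h *: 0 + p.2.1, h *: 1 + p.2.2)) =
  (fun h : R => flat P (n * (a - p.1)) *
    cos ((wave R k).2 * h + ((wave R k).1 * p.2.1 + al + (wave R k).2 * p.2.2))).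
  apply/funext => h; rewrite /= !scaler0 !add0r [_ *: 1]mulr1; congr (_ * _).
  by rewrite /tw /phase /=; congr cos; ring.
apply: is_derive_eq; rewrite /GRing.scale/= mulr0 add0r.
rewrite /tw [phase k p.2 + _]addrA cosDpihalf /phase /wave/= mulNr.
by rewrite [RHS]mulrCA [in RHS]mulrN; congr (_ * - (_ * sin _)); ring.
Qed.

Lemma smooth_wave_test n a P k al : smooth (wave_test n a P k al).
Proof.
move=> vs vsS /=; have [P' [al' ->]] : exists P' al',
    foldr (fun v h => 'D_v h) (wave_test n a P k al) vs = wave_test n a P' k al'.
  elim: vs vsS => [_|v vs IH vsS]; first by exists P, al.
  have [|P' [al' /= ->]] := IH.
    by move=> w wvs; apply: vsS; rewrite in_cons wvs orbT.
  have := vsS v (mem_head _ _); rewrite !inE => /or3P[] /eqP ->.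
  - exists (- n *: flat_deriv P'), al'; apply/funext => p.
    by have [_ ->] := is_derive_wave_test_t n a P' k al' p.
  - exists ((wave R k).1 *: P'), (al' + pi / 2); apply/funext => p.
    by have [_ ->] := is_derive_wave_test_x n a P' k al' p.
  - exists ((wave R k).2 *: P'), (al' + pi / 2); apply/funext => p.
    by have [_ ->] := is_derive_wave_test_y n a P' k al' p.
split; first exact: continuous_wave_test.
move=> p v; rewrite !inE => /or3P[] /eqP ->.
- by have [] := is_derive_wave_test_t n a P' k al' p.
- by have [] := is_derive_wave_test_x n a P' k al' p.
- by have [] := is_derive_wave_test_y n a P' k al' p.
Qed.

Lemma periodic_wave_test n a P k al : torus_periodic (wave_test n a P k al).
Proof.
move=> t x y; rewrite /wave_test /=; split; congr (_ * _); rewrite /tw.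
- rewrite -[RHS](cosD2pi_int _ k.1) -wave1_sqrt2 /phase/=; congr cos; ring.
- by rewrite -[RHS](cosD2pi_int _ k.2) /phase/=; congr cos; rewrite /wave/=; ring.
Qed.

Lemma test_fun_init_wave_test n a P k al : 0 <= n -> a < 1 ->
  test_fun_init (wave_test n a P k al).
Proof.
move=> n0 a1; split.
- exact: smooth_wave_test.
- exact: periodic_wave_test.
- exists a => // t x at_; rewrite /wave_test /flat ltNge.
  by rewrite mulr_ge0_le0 ?subr_le0//= mul0r.
Qed.

End test_functions.

(** * Functions of time and space *)

Section spacetime.
Variable R : realType.
Local Notation mT := (measurableTypeR R).
Local Notation T2 := (mT * mT)%type.
Local Notation TT := (mT * (mT * mT))%type.
Local Notation mux := (@mu_torus R).
Local Notation mut := (@mu_time R).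
Local Notation mus := (@mu_spacetime R).

Lemma mu_time_setT : mut setT = 1%E.
Proof. by rewrite /mu_time lebesgue_on_setT// subr0. Qed.

Lemma ae_mu_time_itv : {ae mut, forall t : mT, 0 <= t <= 1}.
Proof. exact: ae_lebesgue_on_itv. Qed.

Lemma ae_mu_spacetime_time (P : mT -> Prop) :
  {ae mut, forall t : mT, P t} -> {ae mus, forall p : TT, P p.1}.
Proof. exact: (@ae_product1 _ _ _ _ _ mut mux). Qed.

Lemma time_normy_le (nX : (R * R -> R) -> \bar R) (w : R * (R * R) -> R) (M : \bar R) :
  (time_norm +oo nX w <= M)%E ->
  {ae mut, forall t : mT, (nX (fun x => w (t, x)) <= M)%E}.
Proof.
rewrite /time_norm unlock [X in (0 < X)%E]mu_time_setT lte01 => /ess_supP.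
by apply: filterS => t /=; apply: le_trans; exact: lee_abs.
Qed.

Lemma ae_integral_le_cst d (T : measurableType d)
    (m : {finite_measure set T -> \bar R}) (f : T -> \bar R) (C : R) :
  measurable_fun setT f -> (forall x, 0 <= f x)%E -> 0 <= C ->
  {ae m, forall x, (f x <= C%:E)%E} -> (\int[m]_x f x <= C%:E * m setT)%E.
Proof.
move=> mf f0 C0 fC.
rewrite (@ae_eq_integral _ _ _ _ _ (fun x => mine (f x) C%:E))//.
- rewrite -integral_cst//; apply: ge0_le_integral => //.
  + by move=> x _; rewrite le_min f0 lee_fin.
  + exact: measurable_mine.
  + by move=> x _; rewrite ge_min lexx orbT.
- exact: measurable_mine.
- by apply: filterS fC => x fx _; rewrite min_l.
Qed.

Lemma measurable_section (w : TT -> R) t :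
  measurable_fun setT w -> measurable_fun [set: T2] (fun x => w (t, x)).
Proof. by move=> mw; apply: (measurableT_comp mw); exact: pair1_measurable. Qed.

(** A function of L^oo([0, 1], L^2) is bounded in L^2 for almost every time. *)
Lemma LpL2y_bound (w : TT -> R) : LpL2 +oo%E w ->
  exists C : R, {ae mut, forall t : mT, sqint mux (fun x => w (t, x)) /\
    ip mux (fun x => w (t, x)) (fun x => w (t, x)) <= C}.
Proof.
move=> [mw wy]; have [C wC] : exists C : R, (time_norm +oo (@L2norm R) w <= C%:E)%E.
  exists (fine (time_norm +oo (@L2norm R) w)); rewrite fineK// ge0_fin_numE//.
  exact: Lnorm_ge0.
exists (C ^+ 2); apply: filterS (time_normy_le wC) => t tC.
have st : sqint mux (fun x => w (t, x)).
  apply: sqint_finite_Lnorm2; first exact: measurable_section.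
  exact: le_lt_trans tC (ltry _).
split => //; move: tC; rewrite /L2norm sqint_Lnorm2// lee_fin => tC.
rewrite -(sqr_sqrtr (ip_ge0 mux (fun x => w (t, x)))).
by rewrite lerXn2r// ?nnegrE ?sqrtr_ge0// (le_trans _ tC)// sqrtr_ge0.
Qed.

Lemma LpL2y_sqint (w : TT -> R) : LpL2 +oo%E w -> sqint mus w.
Proof.
move=> lw; have [mw _] := lw; have [C wC] := LpL2y_bound lw; split => //.
have mw2 : measurable_fun setT (EFin \o (fun p => w p ^+ 2)).
  exact/measurable_EFinP/measurable_funX.
apply/(@integrable12ltyP _ _ _ _ _ mut mux) => //.
apply: (@le_lt_trans _ _ ((`|C|)%:E * mut setT)%E).
  apply: ae_integral_le_cst => //.
  - apply: (@measurable_fun_fubini_tonelli_F _ _ _ _ _ mux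
      (abse \o (EFin \o (fun p => w p ^+ 2)))); first exact: measurableT_comp.
    by move=> p; exact: abse_ge0.
  - by move=> t; exact: integral_ge0.
  - apply: filterS wC => t [[mt it] tC].
    apply: (@le_trans _ _ (ip mux (fun x => w (t, x)) (fun x => w (t, x)))%:E).
      rewrite /ip /Rintegral fineK; last first.
        by apply: integrable_fin_num => //; under eq_fun do rewrite -expr2.
      rewrite le_eqVlt; apply/orP; left; apply/eqP; apply: eq_integral => x _ /=.
      by rewrite ger0_norm ?sqr_ge0// expr2.
    by rewrite lee_fin (le_trans tC)// ler_norm.
by rewrite mu_time_setT mule1 ltry.
Qed.

(** A function that is square-integrable in space-time belongs to
    L^1([0, 1], L^2), hence can be paired with a weak-* convergent sequence. *)
Lemma sqint_LpL2 (g : TT -> R) : sqint mus g -> LpL2 1%E g.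
Proof.
move=> [mg g2]; split => //.
have mg2 : measurable_fun setT (EFin \o (fun p => g p ^+ 2)).
  exact/measurable_EFinP/measurable_funX.
pose F t := (\int[mux]_x (g (t, x) ^+ 2)%:E)%E.
have mF : measurable_fun setT F.
  apply: (@measurable_fun_fubini_tonelli_F _ _ _ _ _ mux
      (EFin \o (fun p => g p ^+ 2))) => //.
  by move=> p; rewrite lee_fin sqr_ge0.
have F0 t : (0 <= F t)%E by apply: integral_ge0 => x _; rewrite lee_fin sqr_ge0.
have LF t : L2norm (fun x => g (t, x)) = (F t `^ 2^-1)%E.
  rewrite /L2norm unlock; congr (_ `^ _)%E; apply: eq_integral => x _ /=.
  by rewrite (powR_mulrn 2)// real_normK// num_real.
have iF : (\int[mut]_t F t < +oo)%E.
  have /(@integrable12ltyP _ _ _ _ _ mut mux _ mg2) := g2.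
  apply: le_lt_trans; rewrite le_eqVlt; apply/orP; left; apply/eqP.
  apply: eq_integral => t _; apply: eq_integral => x _ /=.
  by rewrite ger0_norm ?sqr_ge0.
rewrite /time_norm Lnorm1.
apply: (@le_lt_trans _ _ (\int[mut]_t (1 + F t))%E); last first.
  rewrite ge0_integralD// integral_cst// mul1e.
  by rewrite [X in (X + _ < _)%E]mu_time_setT lte_add_pinfty// ltry.
apply: ge0_le_integral => //.
- apply: measurableT_comp => //; under eq_fun do rewrite LF.
  exact: (measurableT_comp (measurable_poweR _)).
- exact: emeasurable_funD.
- move=> t _; rewrite LF gee0_abs ?poweR_ge0//.
  case: (F t) (F0 t) => [r|_|//]; last by rewrite addey// leey.
  rewrite lee_fin => r0; rewrite poweR_EFin -EFinD lee_fin powR12_sqrt//.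
  have := sqr_sqrtr r0; have := sqrtr_ge0 r; have := sqr_ge0 (Num.sqrt r - 1).
  by nra.
Qed.

Lemma sqint_ae_bounded (g : TT -> R) (C : R) : measurable_fun setT g ->
  {ae mus, forall p : TT, `|g p| <= C} -> sqint mus g.
Proof.
move=> mg gC; split=> //; apply/integrableP; split.
  exact/measurable_EFinP/measurable_funX.
apply: (@le_lt_trans _ _ ((C ^+ 2)%:E * mus setT)%E).
  apply: ae_integral_le_cst => //.
  - by do 2 apply: measurableT_comp => //; exact: measurable_funX.
  - exact: sqr_ge0.
  - apply: filterS gC => p pC; rewrite lee_fin normrX lerXn2r ?nnegrE//.
    by rewrite (le_trans _ pC).
by rewrite lte_mul_pinfty// ?lee_fin ?sqr_ge0// ltey_eq fin_num_measure.
Qed.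

(** A bounded measurable representative of an essentially bounded function. *)
Lemma Linfty_bounded_rep (v : TT -> R) : v \in Lfun mus +oo%E ->
  exists (vb : TT -> R) (C : R), [/\ measurable_fun setT vb,
    forall p, `|vb p| <= C & {ae mus, forall p : TT, v p = vb p}].
Proof.
rewrite inE => /andP[/[!inE]/= mv vy].
have mus0 : (0 < mus setT)%E.
  rewrite -[X in mus X]setXTT [ltRHS](product_measure1E mut mux measurableT measurableT).
  rewrite -[ltRHS]/(mut setT * mux setT)%E mu_time_setT mul1e.
  rewrite -[X in mux X]setXTT [ltRHS](product_measure1E (lebesgue_on 0 _)
    (lebesgue_on 0 1) measurableT measurableT).
  rewrite -[ltRHS]/(lebesgue_on 0 (Num.sqrt 2) setT * lebesgue_on 0 1 setT)%E.
  by rewrite !lebesgue_on_setT ?sqrtr_ge0// !subr0 mule1 lte_fin sqrtr_gt0.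
move: vy; rewrite /finite_norm unlock mus0 => vy.
have [C vC] : exists C : R, (ess_sup mus (abse \o (EFin \o v)) <= C%:E)%E.
  exists (fine (ess_sup mus (abse \o (EFin \o v)))); rewrite fineK// ge0_fin_numE//.
  by apply: ess_sup_gee => //; apply: nearW => x; exact: abse_ge0.
exists (fun p => Num.max (- `|C|) (Num.min (v p) `|C|)), `|C|; split.
- apply: measurable_maxr; first exact: measurable_cst.
  by apply: measurable_minr.
- move=> p; rewrite ler_norml le_max lexx/= ge_max ge_min lexx orbT andbT.
  by rewrite -subr_ge0 opprK addr_ge0.
- have /ess_supP := vC; apply: filterS => p /=; rewrite lee_fin => pC.
  have : `|v p| <= `|C| by rewrite (le_trans pC)// ler_norm.
  by rewrite ler_norml => /andP[h1 h2]; rewrite min_l// max_r.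
Qed.

End spacetime.

(** * The equation satisfied by the weak limit *)

Section limit_equation.
Variable R : realType.
Local Notation mT := (measurableTypeR R).
Local Notation T2 := (mT * mT)%type.
Local Notation TT := (mT * (mT * mT))%type.
Local Notation mux := (@mu_torus R).
Local Notation mut := (@mu_time R).
Local Notation mus := (@mu_spacetime R).

Lemma measurable_wave_test n a (P : {poly R}) k al :
  measurable_fun [set: TT] (wave_test n a P k al).
Proof.
apply: measurable_funM.
  apply: (@measurableT_comp _ _ _ _ _ _ (flat P)).
    exact: continuous_measurable_fun (@continuous_flat R P).
  by apply: measurable_funM => //; apply: measurable_funB => //; exact: measurable_fst.
apply: (@measurableT_comp _ _ _ _ _ _ (tw k al)); first exact: measurable_tw.
exact: measurable_snd.
Qed.

Lemma flat_time_bounded n a (P : {poly R}) : exists C : R,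
  forall t, 0 <= t <= 1 -> `|flat P (n * (a - t))| <= C.
Proof.
have [C C0 PC] := flat_le P; exists (C * (n ^+ 2 * (`|a| + 1) ^+ 2)) => t /andP[t0 t1].
apply: le_trans (PC _) _; rewrite ler_wpM2l ?(ltW C0)// exprMn.
rewrite ler_wpM2l ?sqr_ge0// -(real_normK (num_real (a - t))).
rewrite lerXn2r ?nnegrE ?addr_ge0//.
by apply: le_trans (ler_normB _ _) _; rewrite lerD2l ger0_norm.
Qed.

Lemma ae_spacetime_itv : {ae mus, forall p : TT, 0 <= p.1 <= 1}.
Proof. by apply: (ae_mu_spacetime_time (P := fun t => 0 <= t <= 1)); exact: ae_mu_time_itv. Qed.

Lemma sqint_wave_test n a (P : {poly R}) k al : sqint mus (wave_test n a P k al).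
Proof.
have [C PC] := flat_time_bounded n a P.
apply: (@sqint_ae_bounded _ _ C); first exact: measurable_wave_test.
apply: filterS ae_spacetime_itv => p /PC pC; apply: le_trans pC.
by rewrite /wave_test normrM ler_piMr// normr_tw.
Qed.

(* (ub1, ub2) is a bounded representative of the vector field u. *)
Variables (u : TT -> R * R) (ub1 ub2 : TT -> R) (Cu : R).
Hypothesis mub1 : measurable_fun setT ub1.
Hypothesis mub2 : measurable_fun setT ub2.
Hypothesis ub1C : forall p, `|ub1 p| <= Cu.
Hypothesis ub2C : forall p, `|ub2 p| <= Cu.
Hypothesis uub : {ae mus, forall p : TT, u p = (ub1 p, ub2 p)}.
Hypothesis mu1 : measurable_fun setT (fst \o u).
Hypothesis mu2 : measurable_fun setT (snd \o u).

(** The derivative of the wave [tw k al] along the vector field; the shift of the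
    phase by pi / 2 turns the cosine into its derivative. *)
Definition transport (k : int * int) (al : R) (p : TT) : R :=
  (ub1 p * (wave R k).1 + ub2 p * (wave R k).2) * tw k (al + pi / 2) p.2.

Lemma measurable_transport k al : measurable_fun setT (transport k al).
Proof.
apply: measurable_funM.
  by apply: measurable_funD; apply: measurable_funM.
apply: (@measurableT_comp _ _ _ _ _ _ (tw k (al + pi / 2))); first exact: measurable_tw.
exact: measurable_snd.
Qed.

Lemma transport_le k al p :
  `|transport k al p| <= Cu * (`|(wave R k).1| + `|(wave R k).2|).
Proof.
have Cu0 : 0 <= Cu by rewrite (le_trans _ (ub1C p)).
rewrite /transport normrM; apply: le_trans (ler_piMr _ (normr_tw _ _ _)) _ => //.
apply: le_trans (ler_normD _ _) _; rewrite !normrM mulrDr.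
by apply: lerD; apply: ler_wpM2r.
Qed.

Lemma sqint_transport k al : sqint mus (transport k al).
Proof.
by apply: sqint_bounded; [exact: measurable_transport|exact: transport_le].
Qed.

Lemma sqint_flat_transport n a (P : {poly R}) k al :
  sqint mus (fun p => flat P (n * (a - p.1)) * transport k al p).
Proof.
have [C PC] := flat_time_bounded n a P.
have [C' C'0 tC] : exists2 C', 0 <= C' & forall p, `|transport k al p| <= C'.
  exists (`|Cu * (`|(wave R k).1| + `|(wave R k).2|)|) => // p.
  by apply: le_trans (transport_le _ _ _) (ler_norm _).
apply: (@sqint_ae_bounded _ _ (C * C')).
  apply: measurable_funM; last exact: measurable_transport.
  apply: (@measurableT_comp _ _ _ _ _ _ (flat P)).
    exact: continuous_measurable_fun (@continuous_flat R P).
  by apply: measurable_funM => //; apply: measurable_funB => //; exact: measurable_fst.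
apply: filterS ae_spacetime_itv => p /PC pC.
by rewrite normrM ler_pM.
Qed.

Lemma advect_wave_test n a (P : {poly R}) k al (p : TT) :
  u p = (ub1 p, ub2 p) ->
  advect u (wave_test n a P k al) p = flat P (n * (a - p.1)) * transport k al p.
Proof.
move=> up; rewrite /advect.
have [_ ->] := is_derive_wave_test_x n a P k al p.
have [_ ->] := is_derive_wave_test_y n a P k al p.
by rewrite up !wave_testZ /wave_test /transport/=; ring.
Qed.

Lemma laplacian_wave_test n a (P : {poly R}) k al :
  laplacian (wave_test n a P k al) =
  wave_test n a (((wave R k).1 ^+ 2 + (wave R k).2 ^+ 2) *: P) k (al + pi / 2 + pi / 2).
Proof.
have ex : 'D_(e_x R) (wave_test n a P k al) = wave_test n a ((wave R k).1 *: P) k (al + pi / 2).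
  by apply/funext => q; have [_ ->] := is_derive_wave_test_x n a P k al q.
have ey : 'D_(e_y R) (wave_test n a P k al) = wave_test n a ((wave R k).2 *: P) k (al + pi / 2).
  by apply/funext => q; have [_ ->] := is_derive_wave_test_y n a P k al q.
apply/funext => p; rewrite /laplacian [X in 'D__ X p + _]ex [X in _ + 'D__ X p]ey.
have [_ ->] := is_derive_wave_test_x n a ((wave R k).1 *: P) k (al + pi / 2) p.
have [_ ->] := is_derive_wave_test_y n a ((wave R k).2 *: P) k (al + pi / 2) p.
by rewrite !wave_testZ; ring.
Qed.

Variables (theta0 : T2 -> R) (W : nat -> TT -> R) (kappa : nat -> R) (theta : TT -> R).
Hypothesis stheta0 : sqint mux theta0.
Hypothesis lW : forall j, LpL2 +oo%E (W j).
Hypothesis Wsol : forall j, solves u (kappa j) theta0 (W j).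
Hypothesis kappa0 : kappa j @[j --> \oo] --> (0 : R).
Hypothesis Wtheta : weak_star_cvg W theta.

(** The weak formulation of the transport equation for theta, with initial datum
    theta0, tested against [wave_test]: the factor kappa j kills the viscous term,
    and all other terms pass to the weak-* limit. *)
Lemma limit_equation n a (P : {poly R}) k al : 0 <= n -> a < 1 ->
  ip mus theta (wave_test n a (- n *: flat_deriv P) k al) +
  ip mus theta (fun p => flat P (n * (a - p.1)) * transport k al p) +
  flat P (n * a) * ip mux theta0 (tw k al) = 0.
Proof.
move=> n0 a1; pose phi := wave_test n a P k al.
pose A := wave_test n a (- n *: flat_deriv P) k al.
pose B := laplacian phi.
pose D p := flat P (n * (a - p.1)) * transport k al p.
have sA : sqint mus A by exact: sqint_wave_test.
have sB : sqint mus B by rewrite /B laplacian_wave_test; exact: sqint_wave_test.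
have sD : sqint mus D by exact: sqint_flat_transport.
have eqj j : ip mus (W j) A + kappa j * ip mus (W j) B + ip mus (W j) D +
    flat P (n * a) * ip mux theta0 (tw k al) = 0.
  have sW := LpL2y_sqint (lW j).
  have [_ /(_ phi (test_fun_init_wave_test P k al n0 a1)) <-] := Wsol j.
  congr (_ + _); last first.
    rewrite /ip -RintegralZl//; last exact: sqintM_integrable (sqint_tw k al).
    by apply: eq_Rintegral => x _; rewrite /phi /wave_test/= subr0; ring.
  have sAB := sqintD sA (sqintZ (kappa j) sB).
  have -> : ip mus (W j) A + kappa j * ip mus (W j) B + ip mus (W j) D =
      ip mus (fun p => A p + kappa j * B p + D p) (W j).
    rewrite (ipDl sAB sD sW) (ipDl sA (sqintZ _ sB) sW) (ipZl _ sB sW).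
    by rewrite !(ipC _ _ (W j)).
  have mWj := sW.1; have mABD := (sqintD sAB sD).1.
  congr fine; apply: ae_eq_integral => //.
  - exact/measurable_EFinP/measurable_funM.
  - apply/measurable_EFinP/measurable_funM => //; apply: measurable_funD.
      apply: measurable_funD.
        rewrite (_ : 'D_(e_t R) phi = A); first exact: sA.1.
        by apply/funext => p; have [_ ->] := is_derive_wave_test_t n a P k al p.
      by apply: measurable_funM => //; exact: sB.1.
    rewrite /advect (_ : (fun p => _) = fun p : TT =>
      (fst \o u) p * wave_test n a ((wave R k).1 *: P) k (al + pi / 2) p +
      (snd \o u) p * wave_test n a ((wave R k).2 *: P) k (al + pi / 2) p).
      by apply: measurable_funD; apply: measurable_funM => //; exact: measurable_wave_test.
    apply/funext => p; have [_ ->] := is_derive_wave_test_x n a P k al p.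
    by have [_ ->] := is_derive_wave_test_y n a P k al p.
  - apply: filterS uub => p up _ /=; congr EFin.
    rewrite advect_wave_test// mulrC; congr (_ * (_ + _ + _)).
    by have [_ ->] := is_derive_wave_test_t n a P k al p.
have cA : ip mus (W j) A @[j --> \oo] --> ip mus theta A.
  exact: (Wtheta (sqint_LpL2 sA)).
have cB : ip mus (W j) B @[j --> \oo] --> ip mus theta B.
  exact: (Wtheta (sqint_LpL2 sB)).
have cD : ip mus (W j) D @[j --> \oo] --> ip mus theta D.
  exact: (Wtheta (sqint_LpL2 sD)).
pose c := flat P (n * a) * ip mux theta0 (tw k al).
have : ip mus (W j) A + kappa j * ip mus (W j) B + ip mus (W j) D + c @[j --> \oo]
    --> ip mus theta A + 0 * ip mus theta B + ip mus theta D + c.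
  apply: cvgD; last exact: cvg_cst.
  by apply: cvgD => //; apply: cvgD => //; apply: cvgM.
under eq_cvg do rewrite eqj; rewrite mul0r addr0 => h.
by apply/esym; apply: (cvg_unique _ (cvg_cst (0 : R)) h); exact: Rhausdorff.
Qed.

End limit_equation.

(** * Continuity in time of the Fourier coefficients *)

Section step_limit.
Variable R : realType.
Implicit Types x a : R.

Lemma expR_harmonic_cvg x : 0 < x ->
  (n.+1%:R * x)^-1 @[n --> \oo] --> (0 : R) /\
  expR (- (n.+1%:R * x)^-1) @[n --> \oo] --> (1 : R).
Proof.
move=> x0; have h : (n.+1%:R * x)^-1 @[n --> \oo] --> (0 : R).
  rewrite (_ : (fun n => _) = fun n => n.+1%:R^-1 * x^-1); last first.
    by apply/funext => n; rewrite invfM.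
  by rewrite -[X in _ --> X](mul0r (x^-1)); apply: cvgM; [exact: cvg_harmonic|exact: cvg_cst].
split => //; rewrite -[X in _ --> X](@expR0 R) -[X in _ --> expR X]oppr0.
by apply: continuous_cvg; [exact: continuous_expR|exact: cvgN].
Qed.

(** With the constant polynomial 1 / n, flat (n x) = x exp (- 1 / (n x)) for
    positive x: these smooth functions converge to the positive part of x, and
    their derivatives to the indicator function of x > 0, with bounds uniform in
    n. *)
Lemma flat_const_cvg x :
  flat (n.+1%:R^-1)%:P (n.+1%:R * x) @[n --> \oo] --> Num.max x 0.
Proof.
have [x0|x0] := leP x 0.
  apply: cvg_near_cst; apply: nearW => n.
  by rewrite /flat ltNge mulr_ge0_le0.
have [_ h] := expR_harmonic_cvg x0.
have E n : flat (n.+1%:R^-1)%:P (n.+1%:R * x) = x * expR (- (n.+1%:R * x)^-1).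
  rewrite /flat mulr_gt0// hornerC; congr (_ * _).
  by rewrite mulrAC divff ?mul1r.
rewrite (_ : (fun n => _) = fun n => x * expR (- (n.+1%:R * x)^-1)); last exact/funext.
by rewrite -[X in _ --> X]mulr1; apply: cvgM => //; exact: cvg_cst.
Qed.

Lemma flat_const_le n x : `|flat (n.+1%:R^-1)%:P (n.+1%:R * x)| <= `|x|.
Proof.
rewrite /flat; case: ifPn => [|_]; last by rewrite normr0.
rewrite pmulr_rgt0// => x0; rewrite hornerC (mulrAC _ x) divff// mul1r.
by rewrite normrM ler_piMr// ger0_norm ?expR_ge0// expR_le1 oppr_le0 invr_ge0 mulr_ge0// ltW.
Qed.

Lemma flat_deriv_const (n : R) y : n != 0 ->
  flat (- n *: flat_deriv (n^-1)%:P) y =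
  if 0 < y then - ((1 + y^-1) * expR (- y^-1)) else 0.
Proof.
move=> n0; rewrite flatZ /flat /flat_deriv.
case: ifPn => [y0|_]; last by rewrite mulr0.
rewrite !(hornerD, hornerN, hornerM, hornerX, hornerXn, hornerC) derivC hornerC.
have y0' : y != 0 by rewrite gt_eqF.
by field; apply/andP.
Qed.

Lemma flat_deriv_const_cvg x :
  flat (- n.+1%:R *: flat_deriv (n.+1%:R^-1)%:P) (n.+1%:R * x) @[n --> \oo] -->
  (- (0 < x)%R%:R : R).
Proof.
rewrite (_ : (fun n => _) = fun n => if 0 < x then
    - ((1 + (n.+1%:R * x)^-1) * expR (- (n.+1%:R * x)^-1)) else 0); last first.
  by apply/funext => n; rewrite flat_deriv_const// pmulr_rgt0.
have [x0|x0] := ltP 0 x; last by rewrite oppr0; exact: cvg_cst.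
have [h1 h2] := expR_harmonic_cvg x0; apply: cvgN.
rewrite [X in _ --> X](_ : _ = (1 + 0) * 1); last by rewrite mulr1 addr0.
by apply: cvgM => //; apply: cvgD => //; exact: cvg_cst.
Qed.

Lemma flat_deriv_const_le n x :
  `|flat (- n.+1%:R *: flat_deriv (n.+1%:R^-1)%:P) (n.+1%:R * x)| <= 1.
Proof.
rewrite flat_deriv_const//; case: ifPn => [y0|_]; last by rewrite normr0.
have z0 : 0 < (n.+1%:R * x)^-1 by rewrite invr_gt0.
rewrite normrN ger0_norm; last by rewrite mulr_ge0 ?expR_ge0// addr_ge0// ltW.
by rewrite expRN ler_pdivrMr ?expR_gt0// mul1r expR_ge1Dx.
Qed.

Lemma measurable_step a :
  measurable_fun [set: measurableTypeR R] (fun t => (t < a)%R%:R : R).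
Proof.
have -> : (fun t => (t < a)%R%:R : R) = \1_(`]-oo, a[%classic : set (measurableTypeR R)).
  apply/funext => t; rewrite indicE (_ : (t \in _) = (t < a))//.
  by apply/idP/idP => [/set_mem|h]; [|apply/mem_set]; rewrite /= in_itv.
by apply: measurable_indic; exact: measurable_itv.
Qed.

End step_limit.

Section modes_in_time.
Variable R : realType.
Local Notation mT := (measurableTypeR R).
Local Notation T2 := (mT * mT)%type.
Local Notation TT := (mT * (mT * mT))%type.
Local Notation mux := (@mu_torus R).
Local Notation mut := (@mu_time R).
Local Notation mus := (@mu_spacetime R).

Lemma ip_dominated_cvg (theta : TT -> R) (g_ : nat -> TT -> R) (g : TT -> R) (C : R) :
  sqint mus theta -> (forall n, measurable_fun setT (g_ n)) -> measurable_fun setT g ->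
  {ae mus, forall p : TT, forall n, `|g_ n p| <= C} ->
  (forall p, g_ n p @[n --> \oo] --> g p) ->
  ip mus theta (g_ n) @[n --> \oo] --> ip mus theta g.
Proof.
move=> sth mg_ mg gC gg; have mth := sth.1.
apply: (@Rintegral_dominated_cvg _ _ _ _ _ _ (fun p => C * `|theta p|)).
- by move=> n; exact: measurable_funM.
- exact: measurable_funM.
- by apply: nearW => p; apply: cvgM => //; exact: cvg_cst.
- have := integrableZl measurableT C (integrable_abse (sqint_integrable sth)).
  by apply: eq_integrable.
- apply: filterS gC => p pC n; rewrite normrM mulrC.
  exact: ler_wpM2r.
Qed.

Variables (ub1 ub2 : TT -> R) (Cu : R).
Hypothesis mub1 : measurable_fun setT ub1.
Hypothesis mub2 : measurable_fun setT ub2.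
Hypothesis ub1C : forall p, `|ub1 p| <= Cu.
Hypothesis ub2C : forall p, `|ub2 p| <= Cu.
Variables (theta0 : T2 -> R) (theta : TT -> R) (k : int * int) (al : R).
Hypothesis ltheta : LpL2 +oo%E theta.
Local Notation V := (transport ub1 ub2 k al).
Hypothesis weak_transport : forall n a (P : {poly R}), 0 <= n -> a < 1 ->
  ip mus theta (wave_test n a (- n *: flat_deriv P) k al) +
  ip mus theta (fun p => flat P (n * (a - p.1)) * V p) +
  flat P (n * a) * ip mux theta0 (tw k al) = 0.

Let sth : sqint mus theta. Proof. exact: LpL2y_sqint. Qed.

(** The weak formulation with the Lipschitz test function max (a - t, 0), the limit
    of smooth ones. *)
Lemma weak_transport_step a : a < 1 ->
  ip mus theta (fun p => (p.1 < a)%R%:R * tw k al p.2) =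
  ip mus theta (fun p => Num.max (a - p.1) 0 * V p) +
  Num.max a 0 * ip mux theta0 (tw k al).
Proof.
move=> a1.
have mV := measurable_transport mub1 mub2 k al.
have mtw2 : measurable_fun [set: TT] (fun p => tw k al p.2).
  apply: (@measurableT_comp _ _ _ _ _ _ (tw k al)); first exact: measurable_tw.
  exact: measurable_snd.
have ma1 : measurable_fun [set: TT] (fun p => a - p.1).
  by apply: measurable_funB => //; exact: measurable_fst.
have mind : measurable_fun [set: TT] (fun p => (p.1 < a)%R%:R : R).
  exact: (measurableT_comp (measurable_step a) (@measurable_fst _ _ mT T2)).
have c1 : ip mus theta (wave_test n.+1%:R a (- n.+1%:R *: flat_deriv (n.+1%:R^-1)%:P) k al)
    @[n --> \oo] --> ip mus theta (fun p => - (p.1 < a)%R%:R * tw k al p.2).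
  apply: (@ip_dominated_cvg _ _ _ 1) => //.
  - by move=> n; exact: measurable_wave_test.
  - by apply: measurable_funM => //; exact: measurableT_comp.
  - apply: nearW => p n; rewrite /wave_test normrM.
    by rewrite mulr_ile1// ?flat_deriv_const_le ?normr_tw.
  - move=> p; apply: cvgM; last exact: cvg_cst.
    by rewrite -subr_gt0; exact: flat_deriv_const_cvg.
have [C' tC] : exists C', forall p, `|V p| <= C'.
  by eexists => p; exact: (transport_le ub1C ub2C).
have c2 : ip mus theta (fun p => flat (n.+1%:R^-1)%:P (n.+1%:R * (a - p.1)) * V p)
    @[n --> \oo] --> ip mus theta (fun p => Num.max (a - p.1) 0 * V p).
  apply: (@ip_dominated_cvg _ _ _ ((`|a| + 1) * C')) => //.
  - move=> n; apply: measurable_funM => //.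
    apply: (@measurableT_comp _ _ _ _ _ _ (flat (n.+1%:R^-1)%:P)).
      exact: continuous_measurable_fun (@continuous_flat R _).
    exact: measurable_funM.
  - by apply: measurable_funM => //; exact: measurable_maxr.
  - apply: filterS (@ae_spacetime_itv R) => p /andP[p0 p1] n.
    rewrite normrM ler_pM//; apply: le_trans (flat_const_le _ _) _.
    by apply: le_trans (ler_normB _ _) _; rewrite lerD2l ger0_norm.
  - by move=> p; apply: cvgM; [exact: flat_const_cvg|exact: cvg_cst].
have c3 : flat (n.+1%:R^-1)%:P (n.+1%:R * a) * ip mux theta0 (tw k al) @[n --> \oo] -->
    Num.max a 0 * ip mux theta0 (tw k al).
  by apply: cvgM; [exact: flat_const_cvg|exact: cvg_cst].
have h : ((fun=> 0) : nat -> R) n @[n --> \oo] -->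
    ip mus theta (fun p => - (p.1 < a)%R%:R * tw k al p.2) +
    ip mus theta (fun p => Num.max (a - p.1) 0 * V p) +
    Num.max a 0 * ip mux theta0 (tw k al).
  rewrite (_ : (fun=> 0) = fun n : nat =>
    ip mus theta (wave_test n.+1%:R a (- n.+1%:R *: flat_deriv (n.+1%:R^-1)%:P) k al) +
    ip mus theta (fun p => flat (n.+1%:R^-1)%:P (n.+1%:R * (a - p.1)) * V p) +
    flat (n.+1%:R^-1)%:P (n.+1%:R * a) * ip mux theta0 (tw k al)).
    by apply: cvgD c3; exact: cvgD c1 c2.
  by apply/funext => n; rewrite weak_transport.
have h0 : lim (((fun=> 0) : nat -> R) n @[n --> \oo]) = 0 by exact: lim_cst.
have := cvg_lim (@Rhausdorff R) h; rewrite h0 => {h0}.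
have -> : ip mus theta (fun p => - (p.1 < a)%R%:R * tw k al p.2) =
    - ip mus theta (fun p => (p.1 < a)%R%:R * tw k al p.2).
  rewrite -mulN1r ipC -[in RHS]ipC -ipZl//.
    by congr ip; apply/funext => p; rewrite mulN1r mulNr.
  apply: (@sqint_bounded _ _ _ _ _ 1); first exact: measurable_funM.
  by move=> p; rewrite normrM mulr_ile1 ?normr_tw//; case: (_ < _); rewrite ?normr1 ?normr0.
by move=> /(_ _) E; lra.
Qed.

End modes_in_time.

Section primitive.
Variable R : realType.
Local Notation mT := (measurableTypeR R).
Local Notation mut := (@mu_time R).
Local Notation leb := (@lebesgue_measure R).

(** The projection onto [0, 1], used to extend to the line a function that only
    matters on [0, 1]. *)
Definition clamp (t : R) : R := Num.max 0 (Num.min 1 t).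

Lemma continuous_clamp : continuous clamp.
Proof.
move=> t; apply: (@continuous_max R R); first exact: cvg_cst.
by apply: (@continuous_min R R); [exact: cvg_cst|exact: cvg_id].
Qed.

Lemma clamp_itv t : 0 <= clamp t <= 1.
Proof. by rewrite /clamp le_max lexx/= ge_max ler01/= ge_min lexx. Qed.

Lemma clamp_id t : 0 <= t <= 1 -> clamp t = t.
Proof. by case/andP => t0 t1; rewrite /clamp min_r// max_r. Qed.

Lemma integrable_lebesgue_on (a b : R) (f : R -> R) :
  (lebesgue_on a b).-integrable setT (EFin \o f) ->
  leb.-integrable setT (EFin \o (f \_ `[a, b])).
Proof.
move=> /integrableP[mf fi].
have mD : measurable (`[a, b]%classic : set mT) by exact: measurable_itv.
rewrite -restrict_EFin; apply: (@integrable_mkcond _ mT R lebesgue_measure _ (EFin \o f) mD).1.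
apply/integrableP; split; first exact: measurable_funS mf.
apply: le_lt_trans fi.
rewrite -(@eq_measure_integral _ _ _ _ leb (lebesgue_on a b)); last first.
  move=> A mA AD; rewrite /lebesgue_on [LHS]/(leb (A `&` _)) setIidl//.
apply: ge0_subset_integral => //.
by apply: measurableT_comp => //; exact: mf.
Qed.

(** If the distributional derivative of f is the integrable function H, with
    initial value c, in the sense of the test functions max (a - t, 0), then f is
    almost everywhere equal to a continuous function, namely on [0, 1] the
    primitive of H with value c at 0. *)
Lemma weak_primitive_continuous (f H : R -> R) (c : R) :
  mut.-integrable setT (EFin \o f) -> mut.-integrable setT (EFin \o H) ->
  (forall a, 0 < a -> a < 1 ->
    \int[mut]_t ((t < a)%R%:R * f t) = \int[mut]_t (Num.max (a - t) 0 * H t) + a * c) ->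
  exists F : R -> R, continuous F /\ {ae mut, forall t : mT, f t = F t}.
Proof.
move=> intf intH fH; pose D := `[0, 1]%classic : set R.
pose f0 := f \_ D; pose H0 := H \_ D; pose tH0 t := t * H0 t.
have if0 : leb.-integrable setT (EFin \o f0) by exact: integrable_lebesgue_on.
have iH0 : leb.-integrable setT (EFin \o H0) by exact: integrable_lebesgue_on.
have itH0 : leb.-integrable setT (EFin \o tH0).
  apply: (le_integrable measurableT _ _ iH0).
    by apply/measurable_EFinP/measurable_funM => //; have /integrableP[/measurable_EFinP] := iH0.
  move=> t _ /=; rewrite lee_fin /tH0 /H0 patchE; case: ifPn => [|_]; last by rewrite mulr0.
  rewrite inE /D/= in_itv/= => /andP[t0 t1].
  by rewrite normrM ler_piMl// ger0_norm.
(* The integration starts at -1, so that 0 is interior to the domain on which S g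
   is continuous and differentiable; f0 and H0 vanish on [-1, 0[. *)
pose S (g : R -> R) x := \int[leb]_(t in `[-1, x]) g t.
have iS (g : R -> R) (I : interval R) : leb.-integrable setT (EFin \o g) ->
    leb.-integrable [set` I] (EFin \o g).
  by move=> ig; apply: integrableS ig => //; exact: measurable_itv.
have mlt := @measurable_step R.
have intI a : mut.-integrable setT (EFin \o (fun t => (t < a)%R%:R * f t)).
  apply: (le_integrable measurableT _ _ intf).
    by apply/measurable_EFinP/measurable_funM => //; have /integrableP[/measurable_EFinP] := intf.
  move=> t _ /=; rewrite lee_fin normrM ler_piMl//.
  by case: (_ < _); rewrite ?normr1 ?normr0.
have S1 a : 0 < a -> a < 1 -> \int[mut]_t ((t < a)%R%:R * f t) = S f0 a.
  move=> a0 a1; rewrite /S -Rintegral_itv_bndo_bndc; last exact: iS.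
  rewrite [LHS](Rintegral_lebesgue_on (intI a)) Rintegral_mkcond [RHS]Rintegral_mkcond.
  apply: eq_Rintegral => t _; rewrite /f0 /D !patchE !mem_setE !in_itv/=.
  have [t0|t0] := leP 0 t; last by rewrite /= if_same.
  rewrite (le_trans _ t0)//= ?lerN10//.
  have [ta|ta] := ltP t a; first by rewrite (ltW (lt_trans ta a1)) mul1r.
  by rewrite mul0r if_same.
have S2 a : 0 < a -> a < 1 -> \int[mut]_t (Num.max (a - t) 0 * H t) = a * S H0 a - S tH0 a.
  move=> a0 a1; have mI : measurable (`[-1, a]%classic : set mT) by exact: measurable_itv.
  rewrite /S -(RintegralZl a mI (iS _ _ iH0)).
  have iaH0 := integrableZl mI a (iS _ `[-1, a] iH0).
  rewrite -(RintegralB mI (f1 := fun t : mT => a * H0 t) iaH0 (iS _ _ itH0)).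
  have mmax : measurable_fun [set: mT] (fun t => Num.max (a - t) 0).
    by apply: measurable_maxr => //; exact: measurable_funB.
  have intM : mut.-integrable setT (EFin \o (fun t => Num.max (a - t) 0 * (H \_ D) t)).
    apply: (le_integrable measurableT _ _ intH).
      apply/measurable_EFinP/measurable_funM => //.
      by have /integrableP[/measurable_EFinP] := iH0.
    move=> t _ /=; rewrite lee_fin normrM patchE.
    case: ifPn => [|_]; last by rewrite normr0 mulr0.
    rewrite inE /D/= in_itv/= => /andP[t0 t1]; rewrite ler_piMl//.
    rewrite ger0_norm ?le_max ?lexx ?orbT// ge_max ler01 andbT.
    by lra.
  have -> : \int[mut]_t (Num.max (a - t) 0 * H t) =
      \int[mut]_t (Num.max (a - t) 0 * (H \_ D) t).
    congr fine; apply: ae_eq_integral => //.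
    - apply/measurable_EFinP/measurable_funM => //.
      by have /integrableP[/measurable_EFinP] := intH.
    - by have /integrableP[] := intM.
    - apply: filterS (@ae_mu_time_itv R) => t t01 _; rewrite patchE.
      by rewrite mem_set// /D /mkset/= in_itv.
  rewrite [LHS](Rintegral_lebesgue_on intM) Rintegral_mkcond [RHS]Rintegral_mkcond.
  apply: eq_Rintegral => t _; rewrite /tH0 /H0 /D !patchE !mem_setE !in_itv/=.
  have [t0|t0] := leP 0 t; last by rewrite /= !mulr0 subrr if_same.
  rewrite (le_trans _ t0)//= ?lerN10//.
  have [ta|ta] := leP t a.
    rewrite (le_trans ta (ltW a1)) max_l ?subr_ge0//; ring.
  by rewrite max_r ?mul0r ?if_same// subr_le0 ltW.
(* Differentiating this identity in a gives f0 = S H0 + c almost everywhere on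
   ]0, 1[, as the terms in a H0 cancel. *)
have SE a : 0 < a -> a < 1 -> S f0 a = a * S H0 a - S tH0 a + a * c.
  by move=> a0 a1; rewrite -S1// -S2// fH.
have FTC (g : R -> R) : leb.-integrable setT (EFin \o g) ->
    {ae leb, forall x : mT, -1 < x -> is_derive (x : R) 1 (S g) (g x)}.
  move=> ig; have := @FTC1 R g (BLeft (-1)) (fun y => iS g _ ig)
    (@open_integrable_locally R _ _ openT ig).
  move=> [N [mN N0 NP]]; exists N; split => // x nx; apply: NP => /= h; apply: nx => x1.
  have [|d1 d2] := h; first by rewrite lte_fin.
  by move: d2; rewrite derive1E => d2; exact: (DeriveDef d1 d2).
exists (fun t => S H0 (clamp t) + c); split.
  move=> t; apply: cvgD; last exact: cvg_cst.
  apply: (@continuous_comp _ _ _ clamp (S H0)); first exact: continuous_clamp.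
  have : {within `[-1, 2], continuous (S H0)}.
    apply: (@parameterized_integral_continuous R (-1) 2 H0); first by lra.
    exact: iS.
  have sub12 : (`]-1, 2[%classic : set R) `<=` `[-1, 2]%classic.
    by move=> y /=; rewrite !in_itv/= => /andP[y1 y2]; rewrite !ltW.
  move=> /(continuous_subspaceW sub12).
  rewrite continuous_open_subspace; last exact: interval_open.
  apply; rewrite inE/= in_itv/=; have /andP[? ?] := clamp_itv t.
  by apply/andP; split; lra.
have h3 : {ae leb, forall x : mT, D x -> f x = S H0 (clamp x) + c}.
  have ae0 (y : R) : {ae leb, forall x : mT, x != y}.
    exists [set y]; split => //; first exact: lebesgue_measure_set1.
    by move=> x /= h; apply/eqP/negPn/negP => xc; apply: h.
  have h1 : {ae leb, forall x : mT, x != 0 /\ x != 1}.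
    by apply: filterS2 (ae0 0) (ae0 1) => x.
  have h2 : {ae leb, forall x : mT, -1 < x -> [/\ is_derive (x : R) 1 (S f0) (f0 x),
      is_derive (x : R) 1 (S H0) (H0 x) & is_derive (x : R) 1 (S tH0) (tH0 x)]}.
    apply: filterS3 (FTC _ if0) (FTC _ iH0) (FTC _ itH0) => x d1 d2 d3 x1.
    by split; [exact: d1|exact: d2|exact: d3].
  apply: filterS2 h1 h2 => x [x0 x1] dx Dx.
  have := Dx; rewrite /D /mkset/= in_itv/= => /andP[x0' x1'].
  have {x0 x0'}x0 : 0 < x by rewrite lt_neqAle eq_sym x0.
  have {x1 x1'}x1 : x < 1 by rewrite lt_neqAle x1.
  have [|d1 d2 d3] := dx; first by lra.
  have cx : clamp x = x by rewrite clamp_id ?ltW.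
  rewrite cx; have dE : is_derive (x : R) 1 (fun a => a * S H0 a - S tH0 a + a * c)
      (S H0 x + c).
    apply: is_derive_eq; rewrite /GRing.scale/= /tH0; ring.
  have dE' : is_derive (x : R) 1 (S f0) (S H0 x + c).
    apply: near_eq_is_derive dE; near=> y; rewrite SE//.
      by near: y; exact: lt_nbhsr.
    by near: y; exact: lt_nbhsl.
  have <- : f0 x = f x by rewrite /f0 patchE mem_set.
  by have [_ <-] := dE'; have [_ ->] := d1.
exact: ae_mfrestr h3.
Unshelve. all: by end_near. Qed.

End primitive.

Section mode_continuity.
Variable R : realType.
Local Notation mT := (measurableTypeR R).
Local Notation T2 := (mT * mT)%type.
Local Notation TT := (mT * (mT * mT))%type.
Local Notation mux := (@mu_torus R).
Local Notation mut := (@mu_time R).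
Local Notation mus := (@mu_spacetime R).

Lemma fubini_weight (c : mT -> R) (G : TT -> R) : measurable_fun setT c ->
  mus.-integrable setT (EFin \o G) ->
  mus.-integrable setT (EFin \o (fun p => c p.1 * G p)) ->
  \int[mus]_p (c p.1 * G p) = \int[mut]_t (c t * \int[mux]_x G (t, x)).
Proof.
move=> mc iG icG; rewrite [LHS](fubini_Rintegral icG).
congr fine; apply: ae_eq_integral => //.
- by apply/measurable_EFinP; exact: (measurable_Rintegral_section icG).
- apply/measurable_EFinP; apply: measurable_funM => //.
  exact: (measurable_Rintegral_section iG).
- by apply: filterS (ae_integrable_section iG) => t iGt _ /=; rewrite RintegralZl.
Qed.

Lemma sqint_tw_time k al : sqint mus (fun p : TT => tw k al p.2).
Proof.
apply: (@sqint_bounded _ _ _ _ _ 1); last by move=> p; exact: normr_tw.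
apply: (@measurableT_comp _ _ _ _ _ _ (tw k al)); first exact: measurable_tw.
exact: measurable_snd.
Qed.

Variables (ub1 ub2 : TT -> R) (Cu : R).
Hypothesis mub1 : measurable_fun setT ub1.
Hypothesis mub2 : measurable_fun setT ub2.
Hypothesis ub1C : forall p, `|ub1 p| <= Cu.
Hypothesis ub2C : forall p, `|ub2 p| <= Cu.
Variables (theta0 : T2 -> R) (theta : TT -> R) (k : int * int) (al : R).
Hypothesis ltheta : LpL2 +oo%E theta.
Local Notation V := (transport ub1 ub2 k al).
Hypothesis weak_transport : forall n a (P : {poly R}), 0 <= n -> a < 1 ->
  ip mus theta (wave_test n a (- n *: flat_deriv P) k al) +
  ip mus theta (fun p => flat P (n * (a - p.1)) * V p) +
  flat P (n * a) * ip mux theta0 (tw k al) = 0.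

Lemma mode_continuous : exists F : R -> R, continuous F /\
  {ae mut, forall t : mT, ip mux (fun x => theta (t, x)) (tw k al) = F t}.
Proof.
have sth : sqint mus theta by exact: LpL2y_sqint.
have iG : mus.-integrable setT (EFin \o (fun p => theta p * tw k al p.2)).
  exact: (sqintM_integrable sth (sqint_tw_time k al)).
have sV : sqint mus V by exact: (sqint_transport mub1 mub2 ub1C ub2C).
have iV : mus.-integrable setT (EFin \o (fun p => theta p * V p)).
  exact: (sqintM_integrable sth sV).
apply: (@weak_primitive_continuous R (fun t => ip mux (fun x => theta (t, x)) (tw k al))
  (fun t => \int[mux]_x (theta (t, x) * V (t, x))) (ip mux theta0 (tw k al))).
- exact: (integrable_Rintegral_section iG).
- exact: (integrable_Rintegral_section iV).
move=> a a0 a1.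
have mlt := measurable_step a.
have mmax : measurable_fun [set: mT] (fun t => Num.max (a - t) 0).
  by apply: measurable_maxr => //; exact: measurable_funB.
have s1 : sqint mus (fun p : TT => (p.1 < a)%R%:R * tw k al p.2).
  apply: (@sqint_bounded _ _ _ _ _ 1).
    apply: measurable_funM; last exact: (sqint_tw_time k al).1.
    exact: (measurableT_comp mlt (@measurable_fst _ _ mT T2)).
  move=> p; rewrite normrM mulr_ile1 ?normr_tw//.
  by case: (_ < _); rewrite ?normr1 ?normr0.
have [C' tC] : exists C', forall p, `|V p| <= C'.
  by eexists => p; exact: (transport_le ub1C ub2C).
have s2 : sqint mus (fun p : TT => Num.max (a - p.1) 0 * V p).
  apply: (@sqint_ae_bounded _ _ C').
    apply: measurable_funM; last exact: sV.1.
    exact: (measurableT_comp mmax (@measurable_fst _ _ mT T2)).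
  apply: filterS (@ae_spacetime_itv R) => p /andP[p0 p1].
  apply: le_trans (tC p); rewrite normrM ler_piMl//.
  rewrite ger0_norm ?le_max ?lexx ?orbT// ge_max ler01 andbT.
  by lra.
have := weak_transport_step mub1 mub2 ub1C ub2C ltheta weak_transport a1.
rewrite {1 2}/ip (max_l (ltW a0)).
have e1 : (fun p : TT => theta p * ((p.1 < a)%R%:R * tw k al p.2)) =
    (fun p : TT => (p.1 < a)%R%:R * (theta p * tw k al p.2)).
  by apply/funext => p; rewrite mulrCA.
have e2 : (fun p : TT => theta p * (Num.max (a - p.1) 0 * V p)) =
    (fun p : TT => Num.max (a - p.1) 0 * (theta p * V p)).
  by apply/funext => p; rewrite mulrCA.
have h1 := sqintM_integrable sth s1; have h2 := sqintM_integrable sth s2.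
rewrite e1 in h1 *; rewrite e2 in h2 *.
by rewrite (fubini_weight mlt iG h1) (fubini_weight mmax iV h2).
Qed.

End mode_continuity.

(** * Bounds in H^s and weak limits *)

Section sobolev_bound.
Variable R : realType.
Local Notation mT := (measurableTypeR R).
Local Notation T2 := (mT * mT)%type.
Local Notation TT := (mT * (mT * mT))%type.
Local Notation mux := (@mu_torus R).
Local Notation mut := (@mu_time R).
Local Notation mus := (@mu_spacetime R).

Lemma eigenval_ge0 k : 0 <= eigenval R k.
Proof. by rewrite addr_ge0 ?sqr_ge0. Qed.

Lemma frac_laplacian_mode s (f g : R * R -> R) i : is_frac_laplacian s f g ->
  ip mux g (mode i) = eigenval R i.1 `^ (s / 2) * ip mux f (mode i).
Proof.
case: i => k b fg; have := fg k; rewrite /fourier => -[re im].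
have s2 : (Num.sqrt 2)^-1 != 0 :> R by rewrite invr_eq0 gt_eqF// sqrt2_gt0.
have ipE (h : R * R -> R) (c : R * R -> R) :
  ip mux h c = \int[mux]_x (h x * c x) by [].
apply: (mulfI s2); rewrite mulrCA; case: b.
- rewrite mode_cos !ipE; move: re; rewrite mul0r subr0 => ->.
  by [].
- rewrite mode_sin !ipE; move: im; rewrite mul0r addr0 mulrN => /oppr_inj.
  by [].
Qed.

(** If the c_i are the coefficients of f on the modes, this is sqrt 2 times the part
    of the squared H^s norm of f carried by the frequencies of size at most N. *)
Definition sobolev_sum s N (c : (int * int) * bool -> R) : R :=
  \sum_(i <- modes N) eigenval R i.1 `^ s * c i ^+ 2.

(** Bessel's inequality for (- Laplacian)^(s / 2) f. The infimum that defines the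
    H^s norm need not be known to be attained, whence M + 1 in place of M. *)
Lemma sobolev_sum_le s M (f : R * R -> R) N : 0 <= M -> (Hsnorm s f <= M%:E)%E ->
  sobolev_sum s N (fun i => ip mux f (mode i)) <= Num.sqrt 2 * (M + 1) ^+ 2.
Proof.
move=> M0 fM; have : (Hsnorm s f < (M + 1)%:E)%E.
  by apply: le_lt_trans fM _; rewrite lte_fin ltrDl.
move=> /ereal_inf_lt[_ [g [g2 fg] <-]].
have sg := Lfun2_sqint g2; rewrite /L2norm sqint_Lnorm2// lte_fin => gM.
rewrite /sobolev_sum (eq_bigr (fun i => ip mux g (mode i) ^+ 2)); last first.
  move=> i _; rewrite (frac_laplacian_mode _ fg) exprMn; congr (_ * _).
  rewrite -powR_mulrn ?powR_ge0// -powRrM; congr (_ `^ _).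
  by rewrite divfK// pnatr_eq0.
apply: (@le_trans _ _ (Num.sqrt 2 * ip mux g g)).
  apply: bessel => //; first exact: sqint_mode.
  by move=> h i sh iN; exact: mode_frame.
apply: ler_wpM2l; first exact: sqrtr_ge0.
rewrite -(sqr_sqrtr (ip_ge0 mux g)) lerXn2r ?nnegrE ?sqrtr_ge0 ?addr_ge0//.
exact: ltW.
Qed.

Lemma ae_le_Rintegral d (T : measurableType d) (m : {measure set T -> \bar R})
    (f g : T -> R) : m.-integrable setT (EFin \o f) -> m.-integrable setT (EFin \o g) ->
  {ae m, forall x, f x <= g x} -> \int[m]_x f x <= \int[m]_x g x.
Proof.
move=> fi gi fg; have mf := (measurable_EFinP _ _).1 (measurable_int _ fi).
have mg := (measurable_EFinP _ _).1 (measurable_int _ gi).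
have mm : measurable_fun setT (f \max g) by exact: measurable_maxr.
have -> : \int[m]_x g x = \int[m]_x (f \max g) x.
  congr fine; apply: ae_eq_integral => //; do ?exact/measurable_EFinP.
  by apply: filterS fg => x fgx _ /=; rewrite max_r.
apply: le_Rintegral => //; last by move=> x _ /=; rewrite le_max lexx.
have := integrableD measurableT (integrable_abse fi) (integrable_abse gi).
apply: le_integrable => //; first exact/measurable_EFinP.
move=> x _ /=; rewrite lee_fin (ger0_norm (addr_ge0 (normr_ge0 _) (normr_ge0 _))).
by case: (leP (f x) (g x)) => _; rewrite ?lerDl ?lerDr.
Qed.

Lemma ae_all_modes (P : (int * int) * bool -> mT -> Prop) :
  (forall i, {ae mut, forall t : mT, P i t}) -> {ae mut, forall t : mT, forall i, P i t}.
Proof.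
move=> aP; have : {ae mut, forall t : mT, forall n,
    if unpickle n is Some i then P i t else True}.
  by apply: ae_foralln => n; case: (unpickle n) => [i|]; [exact: aP|exact: nearW].
by apply: filterS => t h i; have := h (pickle i); rewrite pickleK.
Qed.

Lemma frequently_cvg_le (x_ : nat -> R) (x c : R) : x_ j @[j --> \oo] --> x ->
  (forall N, exists2 j, (N <= j)%N & x_ j <= c) -> x <= c.
Proof.
move=> xx fr; rewrite leNgt; apply/negP => cx.
have [N _ h] := cvgr_gt _ xx _ cx.
have [j Nj] := fr N.
by rewrite leNgt => /negP; apply; exact: h.
Qed.

Lemma continuous_bounded01 (F : R -> R) : continuous F ->
  exists C : R, forall t, 0 <= t <= 1 -> `|F t| <= C.
Proof.
move=> cF; have cnF : {within `[0, 1], continuous (fun t => `|F t|)}.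
  apply: continuous_subspaceT => t.
  by apply: (@continuous_comp _ _ _ F (@Num.norm R R)); [exact: cF|exact: norm_continuous].
have [c _ h] := EVT_max ler01 cnF.
by exists `|F c| => t t01; apply: h; rewrite in_itv.
Qed.

Lemma mu_time_itv_gt0 (t0 r : R) : 0 <= t0 <= 1 -> 0 < r ->
  (0 < mut `](t0 - r)%R, (t0 + r)%R[%classic)%E.
Proof.
move=> /andP[t00 t01] r0; pose a := Num.max 0 (t0 - r); pose b := Num.min 1 (t0 + r).
have ab : a < b.
  by rewrite gt_max !lt_min; apply/andP; split; apply/andP; split; lra.
rewrite [ltRHS]/(@lebesgue_measure R (`]t0 - r, t0 + r[ `&` `[0, 1])).
apply: (@lt_le_trans _ _ (@lebesgue_measure R `]a, b[%classic)).
  by rewrite lebesgue_measure_itv/= lte_fin ab -EFinD lte_fin subr_gt0.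
apply: le_measure; rewrite ?inE.
- exact: measurable_itv.
- by apply: measurableI; exact: measurable_itv.
- move=> t /=; rewrite !in_itv/= /a /b gt_max lt_min => /andP[/andP[? ?] /andP[? ?]].
  by split; apply/andP; split; lra.
Qed.

End sobolev_bound.

Section lower_semicontinuity.
Variable R : realType.
Local Notation mT := (measurableTypeR R).
Local Notation T2 := (mT * mT)%type.
Local Notation TT := (mT * (mT * mT))%type.
Local Notation mux := (@mu_torus R).
Local Notation mut := (@mu_time R).
Local Notation mus := (@mu_spacetime R).

Lemma ae_ip_section (w : TT -> R) (I : eqType) (s : seq I) (c : I -> mT -> R)
    (e : I -> T2 -> R) : LpL2 +oo%E w -> (forall i, sqint mux (e i)) ->
  {ae mut, forall t : mT, \int[mux]_x (w (t, x) * \sum_(i <- s) c i t * e i x) =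
    \sum_(i <- s) c i t * ip mux (fun x => w (t, x)) (e i)}.
Proof.
move=> lw se; have [C wC] := LpL2y_bound lw.
apply: filterS wC => t [sw _].
transitivity (ip mux (fun x => \sum_(i <- s) c i t * e i x) (fun x => w (t, x))).
  by apply: eq_Rintegral => x _; rewrite mulrC.
by rewrite ip_suml//; apply: eq_bigr => i _; rewrite ipC.
Qed.

Lemma continuous_bigsum (I : Type) (s : seq I) (f : I -> R -> R) :
  (forall i, continuous (f i)) -> continuous (fun t => \sum_(i <- s) f i t).
Proof.
move=> cf; elim: s => [|i s IH] t.
  rewrite (_ : (fun t => _) = fun=> 0); first exact: cvg_cst.
  by apply/funext => y; rewrite big_nil.
rewrite (_ : (fun t => _) = fun t => f i t + \sum_(i <- s) f i t).
  by apply: cvgD; [exact: cf|exact: IH].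
by apply/funext => y; rewrite big_cons.
Qed.

Lemma continuous_sobolev_sum s N (c : (int * int) * bool -> R -> R) :
  (forall i, continuous (c i)) -> continuous (fun t => sobolev_sum s N (fun i => c i t)).
Proof.
move=> cc; apply: (@continuous_bigsum _ (modes N)
  (fun i t => eigenval R i.1 `^ s * c i t ^+ 2)) => i t.
by apply: cvgM; [exact: cvg_cst|apply: cvgM; exact: cc].
Qed.

Variables (W : nat -> TT -> R) (theta : TT -> R) (B s : R).
Variable F : (int * int) * bool -> R -> R.
Hypothesis lW : forall j, LpL2 +oo%E (W j).
Hypothesis ltheta : LpL2 +oo%E theta.
Hypothesis Wtheta : weak_star_cvg W theta.
Hypothesis cF : forall i, continuous (F i).
Hypothesis thetaF : forall i, {ae mut, forall t : mT,
  ip mux (fun x => theta (t, x)) (mode i) = F i t}.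
Hypothesis WB : forall n, exists2 j, (n <= j)%N & {ae mut, forall t : mT, forall N,
  sobolev_sum s N (fun i => ip mux (fun x => W j (t, x)) (mode i)) <= B}.

(** Lower semicontinuity of the H^s norm under weak convergence. The bound on the
    limit holds at every t of [0, 1], and not just almost everywhere, because the
    F_i are continuous. *)
Lemma sobolev_sum_lsc N t : 0 <= t <= 1 -> sobolev_sum s N (fun i => F i t) <= B.
Proof.
(* If the sum S of the lambda_i^s F_i^2 exceeds B at t0, it exceeds B + del on an
   interval J around t0. *)
move: t => t0 t001; rewrite leNgt; apply/negP => BS.
pose S t := sobolev_sum s N (fun i => F i t).
have {}BS : B < S t0 by [].
have cS : continuous S by exact: continuous_sobolev_sum.
pose del := (S t0 - B) / 2; have del0 : 0 < del by rewrite divr_gt0// subr_gt0.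
have [r r0 Sr] : exists2 r, 0 < r & forall t, t0 - r < t < t0 + r -> B + del < S t.
  have : B + del < S t0 by rewrite /del; lra.
  move=> /(cvgr_gt _ (cS t0)) [r /= r0 h]; exists r => // t tr.
  by apply: h; rewrite /ball_/= ltr_distlC; move: tr => /andP[? ?]; apply/andP; split; lra.
pose J := `]t0 - r, t0 + r[%classic : set mT.
have mJ : measurable J by exact: measurable_itv.
pose chi : mT -> R := \1_J.
have chi01 t : 0 <= chi t <= 1.
  by rewrite /chi indicE; case: (_ \in _); rewrite lexx ler01.
have mchi : measurable_fun setT chi by exact: measurable_indic.
have mF i : measurable_fun [set: mT] (F i) by exact: continuous_measurable_fun.
have mS : measurable_fun [set: mT] S by exact: continuous_measurable_fun.
(* The pairing of theta with the test function g is the integral of S over J. *)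
pose c i t := eigenval R i.1 `^ s * (chi t * F i t).
pose g (p : TT) := \sum_(i <- modes N) c i p.1 * mode i p.2.
have sg : sqint mus g.
  have h i : sqint mus (fun p => (chi p.1 * F i p.1) * mode i p.2).
    have [C FC] := continuous_bounded01 (@cF i).
    apply: (@sqint_ae_bounded _ _ C).
      apply: measurable_funM; last exact: (sqint_tw_time _ _).1.
      apply: (@measurableT_comp _ _ _ _ _ _ (fun t : mT => chi t * F i t)).
        exact: measurable_funM.
      exact: measurable_fst.
    apply: filterS (@ae_spacetime_itv R) => p /FC pC; apply: le_trans pC.
    rewrite !normrM -mulrA; have /andP[c0 c1] := chi01 p.1.
    rewrite (ger0_norm c0); apply: le_trans (ler_piMl _ c1) _ => //.
    by rewrite ler_piMr// normr_tw.
  have := @sqint_sum _ _ _ mus _ (modes N) (fun i => eigenval R i.1 `^ s) _ h.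
  by congr sqint; apply/funext => p; apply: eq_bigr => i _; rewrite /c; ring.
have Fub (w : TT -> R) : LpL2 +oo%E w -> mut.-integrable setT
    (EFin \o (fun t => \int[mux]_x (w (t, x) * g (t, x)))) /\
    ip mus w g = \int[mut]_t \int[mux]_x (w (t, x) * g (t, x)).
  move=> lw; have ig := sqintM_integrable (LpL2y_sqint lw) sg.
  by split; [exact: (integrable_Rintegral_section ig)|exact: (fubini_Rintegral ig)].
have sec (w : TT -> R) : LpL2 +oo%E w -> {ae mut, forall t : mT,
    \int[mux]_x (w (t, x) * g (t, x)) =
    \sum_(i <- modes N) c i t * ip mux (fun x => w (t, x)) (mode i)}.
  by move=> lw; apply: ae_ip_section => //; exact: sqint_mode.
have [CS SC] := continuous_bounded01 cS.
have bnd (h : mT -> R) (C : R) : measurable_fun setT h ->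
    (forall t, 0 <= t <= 1 -> `|h t| <= C) -> mut.-integrable setT (EFin \o h).
  move=> mh hC; apply/integrableP; split; first exact/measurable_EFinP.
  have C0 : 0 <= C by apply: le_trans (hC 0 _); rewrite // lexx ler01.
  apply: (@le_lt_trans _ _ (C%:E * mut setT)%E).
    apply: ae_integral_le_cst => //.
    - by apply: measurableT_comp => //; exact/measurable_EFinP.
    - by apply: filterS (@ae_mu_time_itv R) => t /hC; rewrite lee_fin.
  by rewrite mu_time_setT mule1 ltry.
have ichi : mut.-integrable setT (EFin \o chi).
  by apply: (bnd _ 1) => // t _; have /andP[? ?] := chi01 t; rewrite ger0_norm.
have ichiS : mut.-integrable setT (EFin \o (fun t => chi t * S t)).
  apply: (bnd _ CS); first exact: measurable_funM.
  move=> t /SC tC; apply: le_trans tC; have /andP[? ?] := chi01 t.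
  by rewrite normrM ler_piMl// ger0_norm.
have imid : mut.-integrable setT (EFin \o (fun t => chi t * (2^-1 * (B + S t)))).
  apply: (bnd _ (2^-1 * (`|B| + CS))).
    by apply: measurable_funM => //; apply: measurable_funM => //; exact: measurable_funD.
  move=> t /SC tC; have /andP[? ?] := chi01 t; rewrite normrM.
  apply: le_trans (ler_piMl _ _) _ => //; first by rewrite ger0_norm.
  rewrite normrM ger0_norm// ler_wpM2l//.
  by apply: le_trans (ler_normD _ _) _; rewrite lerD2l.
(* Since a b <= (a^2 + b^2) / 2, the pairing of W j with g is at most the integral
   of (B + S) / 2 over J for infinitely many j. *)
have lim : ip mus theta g <= \int[mut]_t (chi t * (2^-1 * (B + S t))).
  apply: (frequently_cvg_le (Wtheta (sqint_LpL2 sg))) => n.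
  have [j nj jB] := WB n; exists j => //.
  have [i1 e1] := Fub _ (lW j); rewrite -/(ip mus (W j) g) e1.
  apply: ae_le_Rintegral => //.
  apply: filterS2 (sec _ (lW j)) jB => t -> tB.
  have /andP[x0 x1] := chi01 t.
  apply: (@le_trans _ _ (chi t * (2^-1 * (sobolev_sum s N
      (fun i => ip mux (fun x => W j (t, x)) (mode i)) + S t)))); last first.
    by rewrite ler_wpM2l// ler_wpM2l// lerD2r.
  rewrite /S /sobolev_sum -big_split/= !big_distrr/=; apply: ler_sum => i _.
  rewrite /c; set w := _ `^ _; set a := ip _ _ _; set b := F i t.
  have w0 : 0 <= w by exact: powR_ge0.
  have -> : w * (chi t * b) * a = chi t * (w * (a * b)) by ring.
  rewrite ler_wpM2l// -mulrDr [leRHS]mulrCA ler_wpM2l//.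
  by have := sqr_ge0 (a - b); nra.
have low : ip mus theta g = \int[mut]_t (chi t * S t).
  have [i1 ->] := Fub _ ltheta; congr fine; apply: ae_eq_integral => //.
  - exact: measurable_int i1.
  - exact: measurable_int ichiS.
  - apply: filterS2 (sec _ ltheta) (ae_all_modes thetaF) => t -> tF _ /=; congr EFin.
    rewrite /S /sobolev_sum big_distrr/=.
    by apply: eq_bigr => i _; rewrite tF /c; ring.
have chiJ : \int[mut]_t chi t = fine (mut J).
  by rewrite /Rintegral integral_indic// setIT.
have Jpos : 0 < \int[mut]_t chi t.
  by rewrite chiJ fine_gt0// mu_time_itv_gt0//= ltey_eq fin_num_measure.
have : \int[mut]_t (chi t * (2^-1 * (B + S t))) + 2^-1 * del * \int[mut]_t chi t <=
    \int[mut]_t (chi t * S t).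
  rewrite -RintegralZl// -RintegralD//; last exact: (integrableZl measurableT _ ichi).
  apply: le_Rintegral => //.
    have := integrableD measurableT imid (integrableZl measurableT (2^-1 * del) ichi).
    exact: eq_integrable.
  move=> t _; have [tJ|tJ] := boolP (t \in J); last first.
    by rewrite /chi indicE (negbTE tJ) !mul0r mulr0 addr0.
  rewrite /chi indicE tJ !mul1r mulr1.
  have : B + del < S t by apply: Sr; move/set_mem: tJ; rewrite /J /mkset/= in_itv.
  by lra.
rewrite -low; move: lim; have : 0 < 2^-1 * del * \int[mut]_t chi t.
  by rewrite mulr_gt0// mulr_gt0.
by lra.
Qed.

End lower_semicontinuity.

(** * Continuity of the energy *)

Section energy_continuity.
Variable R : realType.
Local Notation mT := (measurableTypeR R).
Local Notation T2 := (mT * mT)%type.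
Local Notation TT := (mT * (mT * mT))%type.
Local Notation mux := (@mu_torus R).
Local Notation mut := (@mu_time R).
Local Notation mus := (@mu_spacetime R).

Lemma ler_sqr_int (N : nat) (k : int) : N%:Z < `|k| -> N.+1%:R <= (k%:~R : R) ^+ 2.
Proof.
move=> Nk; have : N.+1%:Z <= k ^+ 2 by nia.
by rewrite -(ler_int R) rmorphXn.
Qed.

Lemma eigenval_ge N k : k \notin freqs N -> N.+1%:R <= eigenval R k.
Proof.
have p2 : 4 <= pi ^+ 2 :> R by have := pi_ge2 R; nra.
have w1 : (wave R k).1 ^+ 2 = 2 * pi ^+ 2 * (k.1%:~R) ^+ 2.
  rewrite /wave/= !exprMn exprVn sqr_sqrtr//; by field.
have w2 : (wave R k).2 ^+ 2 = 4 * pi ^+ 2 * (k.2%:~R) ^+ 2.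
  by rewrite /wave/= !exprMn; ring.
have s1 := sqr_ge0 (k.1%:~R : R); have s2 := sqr_ge0 (k.2%:~R : R).
rewrite /eigenval w1 w2 mem_freqs negb_and -!ltNge => /orP[] /ler_sqr_int; nra.
Qed.

(** A bound on the H^s norm controls the high frequencies. *)
Lemma sobolev_tail s N M (c : (int * int) * bool -> R) : 0 <= s -> (N <= M)%N ->
  N.+1%:R `^ s * (\sum_(i <- modes M) c i ^+ 2 - \sum_(i <- modes N) c i ^+ 2) <=
  sobolev_sum s M c.
Proof.
move=> s0 NM; rewrite (sum_modes_split _ NM) addrAC subrr add0r.
rewrite /sobolev_sum (sum_modes_split _ NM) mulr_sumr ler_wpDl//.
  by apply: sumr_ge0 => i _; rewrite mulr_ge0 ?sqr_ge0 ?powR_ge0.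
apply: ler_sum => i; rewrite mem_modes => /eigenval_ge h.
by rewrite ler_wpM2r ?sqr_ge0// ge0_ler_powR ?nnegrE ?eigenval_ge0.
Qed.

Lemma exists_div_powR_le s (K e : R) : 0 < s -> 0 <= K -> 0 < e ->
  exists N, K / N.+1%:R `^ s <= e.
Proof.
move=> s0 K0 e0; pose x := (K / e) `^ s^-1.
have Ke : 0 <= K / e by rewrite divr_ge0// ltW.
exists (Num.bound x); rewrite ler_pdivrMr ?powR_gt0// mulrC -ler_pdivrMr//.
have -> : K / e = x `^ s by rewrite /x -powRrM mulVf ?gt_eqF// powRr1.
rewrite ge0_ler_powR ?nnegrE ?powR_ge0 ?(ltW s0)//.
apply: le_trans (ltW (archi_boundP (powR_ge0 _ _))) _.
by rewrite ler_nat leqnSn.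
Qed.

Lemma uniform_limit_cts (G : nat -> R -> R) (c : R -> R) :
  (forall N, continuous (G N)) ->
  (forall e, 0 < e -> exists N, forall t, `|c t - G N t| <= e) -> continuous c.
Proof.
move=> cG Gc t; apply/cvgrPdist_le => e e0.
have e3 : 0 < e / 3 by rewrite divr_gt0.
have [N GN] := Gc (e / 3) e3; have /cvgrPdist_le /(_ (e / 3) e3) := cG N t.
apply: filterS => y yt.
have -> : c t - c y = (c t - G N t) + (G N t - G N y) - (c y - G N y) by ring.
apply: le_trans (ler_normB _ _) _; apply: le_trans (lerD (ler_normD _ _) (lexx _)) _.
have := GN t; have := GN y; lra.
Qed.

(** A uniform bound on the weighted sums makes the sums of squares converge
    uniformly on [0, 1], hence to a continuous function. *)
Lemma energy_limit s (B : R) (F : (int * int) * bool -> R -> R) : 0 < s ->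
  (forall i, continuous (F i)) ->
  (forall N t, 0 <= t <= 1 -> sobolev_sum s N (fun i => F i t) <= B) ->
  exists2 c : R -> R, continuous c & forall t, 0 <= t <= 1 ->
    \sum_(i <- modes N) F i t ^+ 2 @[N --> \oo] --> c t.
Proof.
move=> s0 cF FB; pose G N t := \sum_(i <- modes N) F i (clamp t) ^+ 2.
have cG N : continuous (G N).
  apply: (@continuous_bigsum _ _ _ (fun i t => F i (clamp t) ^+ 2)) => i t.
  have h : {for t, continuous (F i \o @clamp R)}.
    by apply: continuous_comp; [exact: continuous_clamp|exact: cF].
  by apply: cvgM; exact: h.
have ndG t : {homo G^~ t : n m / (n <= m)%N >-> n <= m}.
  move=> N M NM; rewrite /G (sum_modes_split _ NM) lerDl sumr_ge0// => i _; exact: sqr_ge0.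
have tG N M t : (N <= M)%N -> G M t <= G N t + B / N.+1%:R `^ s.
  move=> NM; rewrite -lerBlDl ler_pdivlMr ?powR_gt0// mulrC.
  by apply: le_trans (FB M _ (clamp_itv t)); exact: sobolev_tail (ltW s0) NM.
have cvG t : cvgn (G^~ t).
  apply: nondecreasing_is_cvgn; first exact: ndG.
  by exists (G 0%N t + B / 1%:R `^ s) => _ [N _ <-]; exact: tG.
exists (fun t => limn (G^~ t)).
  apply: (uniform_limit_cts cG) => e e0.
  have B0 : 0 <= B.
    apply: le_trans (FB 0%N 0 _); last by rewrite lexx ler01.
    by apply: sumr_ge0 => i _; rewrite mulr_ge0 ?powR_ge0 ?sqr_ge0.
  have [N NB] := exists_div_powR_le s0 B0 e0; exists N => t.
  rewrite ger0_norm ?subr_ge0; last exact: (nondecreasing_cvgn_le (@ndG t)).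
  rewrite lerBlDl; apply: limr_le; first exact: cvG.
  exists N => // M /= NM; apply: le_trans (tG _ _ t NM) _.
  by rewrite lerD2l.
move=> t t01; rewrite (_ : (fun N => _) = G^~ t); first exact: cvG.
by apply/funext => N; rewrite /G clamp_id.
Qed.

Lemma energy_sqint (theta : TT -> R) t : sqint mux (fun x => theta (t, x)) ->
  energy theta t = (ip mux (fun x => theta (t, x)) (fun x => theta (t, x)))%:E.
Proof.
move=> st; rewrite /energy /L2norm sqint_Lnorm2// -EFin_expe.
by rewrite sqr_sqrtr// ip_ge0.
Qed.

(** If the Fourier coefficients of a weak limit theta are continuous in time, and
    infinitely many terms of the sequence satisfy a common bound in H^s, then the
    energy of theta is almost everywhere equal to a continuous function. *)
Lemma energy_continuous (W : nat -> TT -> R) (theta : TT -> R) (B s : R)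
    (F : (int * int) * bool -> R -> R) : 0 < s ->
  (forall j, LpL2 +oo%E (W j)) -> LpL2 +oo%E theta -> weak_star_cvg W theta ->
  (forall i, continuous (F i)) ->
  (forall i, {ae mut, forall t : mT,
    ip mux (fun x => theta (t, x)) (mode i) = F i t}) ->
  (forall n, exists2 j, (n <= j)%N & {ae mut, forall t : mT, forall N,
    sobolev_sum s N (fun i => ip mux (fun x => W j (t, x)) (mode i)) <= B}) ->
  exists c : R -> R, continuous c /\ {ae mut, forall t : mT, energy theta t = (c t)%:E}.
Proof.
move=> s0 lW lt Wt cF tF WB.
have [c cc Fc] := energy_limit s0 cF (sobolev_sum_lsc lW lt Wt cF tF WB).
exists (fun t => (Num.sqrt 2)^-1 * c t); split.
  by move=> t; apply: cvgM; [exact: cvg_cst|exact: cc].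
have [C bt] := LpL2y_bound lt.
apply: filterS2 (filterI bt (ae_mu_time_itv R)) (ae_all_modes tF) => t [[st _] t01] tFt.
rewrite energy_sqint//; congr EFin.
have [_ par] := parseval_sqint st.
have lim : fourier_residual N (fun x => theta (t, x)) @[N --> \oo] -->
    ip mux (fun x => theta (t, x)) (fun x => theta (t, x)) - (Num.sqrt 2)^-1 * c t.
  apply: cvgB; first exact: cvg_cst.
  apply: cvgM; first exact: cvg_cst.
  rewrite (_ : (fun N => _) = fun N => \sum_(i <- modes N) F i t ^+ 2); first exact: Fc.
  by apply/funext => N; apply: eq_bigr => i _; rewrite tFt.
have /(_ _) := cvg_lim (@Rhausdorff R) lim.
by rewrite (cvg_lim (@Rhausdorff R) par) => /esym/subr0_eq.
Qed.

End energy_continuity.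

Theorem proposition1p10 (R : realType)
  (u : R * (R * R) -> R * R) (theta0 : R * R -> R)
  (Hu : Linfty_field u) (Hdiv : divergence_free u)
  (Htheta0 : theta0 \in Lfun mu_torus 2%:E)
  (thetak : R -> R * (R * R) -> R)
  (Hsol : forall k : R, 0 < k -> solves u k theta0 (thetak k))
  (theta : R * (R * R) -> R) (Htheta : LpL2 +oo%E theta)
  (kappa : nat -> R) (Hkappa : forall j, 0 < kappa j)
  (Hkappa0 : kappa j @[j --> \oo] --> (0 : R))
  (Hweak : weak_star_cvg (fun j => thetak (kappa j)) theta)
  (HE : ~ exists c : R -> R, {within `[0, 1], continuous c} /\
          {ae mu_time, forall t, energy theta t = (c t)%:E})
  (s : R) (Hs : 0 < s) :
  time_norm +oo%E (Hsnorm s) (thetak (kappa j)) @[j --> \oo] --> +oo%E.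
Proof.
have lW j : LpL2 +oo%E (thetak (kappa j)) by have [] := Hsol _ (Hkappa j).
have Wsol j : solves u (kappa j) theta0 (thetak (kappa j)) by exact: Hsol.
have mLfun v : v \in Lfun (@mu_spacetime R) +oo%E -> measurable_fun setT v.
  by rewrite inE => /andP[/[!inE]].
have [mu1 mu2] := (mLfun _ Hu.1, mLfun _ Hu.2).
have [[ub1 [C1 [mub1 ub1C uub1]]] [ub2 [C2 [mub2 ub2C uub2]]]] :=
  (Linfty_bounded_rep Hu.1, Linfty_bounded_rep Hu.2).
pose Cu := Num.max C1 C2.
have {}ub1C p : `|ub1 p| <= Cu by rewrite /Cu le_max ub1C.
have {}ub2C p : `|ub2 p| <= Cu by rewrite /Cu le_max ub2C orbT.
have uub : {ae mu_spacetime, forall p : measurableTypeR R *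
    (measurableTypeR R * measurableTypeR R), u p = (ub1 p, ub2 p)}.
  by apply: filterS2 uub1 uub2 => p /= <- <-; case: (u p).
(* The Fourier coefficients of theta are continuous in time. *)
have cont i : exists F : R -> R, continuous F /\ {ae mu_time, forall t : measurableTypeR R,
    ip mu_torus (fun x => theta (t, x)) (mode i) = F t}.
  apply: (mode_continuous mub1 mub2 ub1C ub2C Htheta (theta0 := theta0)).
  move=> n a P n0 a1.
  exact: (limit_equation mub1 mub2 ub1C ub2C uub mu1 mu2 (Lfun2_sqint Htheta0) lW Wsol
    Hkappa0 Hweak P _ _ n0 a1).
have [F cF] := choice cont.
(* Otherwise, the norms are at most M for infinitely many j. *)
apply/cvgeyPge => M; apply: contrapT => nM; apply: HE.
pose M1 := Num.max 0 M; have M0 : 0 <= M1 by rewrite le_max lexx.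
have [|c [cc cE]] := energy_continuous Hs lW Htheta Hweak
    (fun i => (cF i).1) (fun i => (cF i).2) (B := Num.sqrt 2 * (M1 + 1) ^+ 2).
  move=> n; have [j nj jM] : exists2 j, (n <= j)%N &
      (time_norm +oo (Hsnorm s) (thetak (kappa j)) <= M1%:E)%E.
    apply: contrapT => nj; apply: nM; exists n => // j /= nj'.
    rewrite leNgt; apply/negP => jM; apply: nj; exists j => //.
    by rewrite (le_trans (ltW jM))// lee_fin le_max lexx orbT.
  exists j => //; apply: filterS (time_normy_le jM) => t tM N.
  exact: sobolev_sum_le.
by exists c; split => //; exact: continuous_subspaceT.
Qed.
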